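(* There is an absolute constant $c>0$ such that for every connected graph $G$ with $n$ vertices in which every edge $e$ has effective conductance $C_e\ge\kappa>0$, $G$ has a spanning tree $T$ with $L_T\preceq (c/\kappa)L_G$.
   Context: For a graph $H$ on vertex set $V=[n]$, its Laplacian is $L_H=\sum_{uv\in E(H)}(e_u-e_v)(e_u-e_v)^{\top}$. For an edge $e=uv$ of $G$, the effective resistance is $R_e=(e_u-e_v)^{\top}L_G^{+}(e_u-e_v)$ ($L_G^+$ the Moore–Penrose pseudoinverse) and the effective conductance is $C_e=1/R_e$. $\preceq$ is the Löwner order. *)

(* Defs.v *)
From HB Require Import structures.
From mathcomp Require Import all_boot all_order all_algebra.
Set Implicit Arguments. Unset Strict Implicit. Unset Printing Implicit Defensive.
Import Order.TTheory GRing.Theory Num.Theory.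
Local Open Scope ring_scope.

Definition simple_graph (n : nat) (G : rel 'I_n) : Prop :=
  (forall u v, G u v = G v u) /\ (forall u, ~~ G u u).

Definition subgraph (n : nat) (H G : rel 'I_n) : Prop := forall u v, H u v -> G u v.

Definition connected_graph (n : nat) (G : rel 'I_n) : Prop :=
  forall u v : 'I_n, connect G u v.

Definition num_edges (n : nat) (G : rel 'I_n) : nat :=
  #|[set p : 'I_n * 'I_n | (p.1 < p.2)%N && G p.1 p.2]|.

(* Spanning tree of G: connected spanning subgraph with n-1 edges
   (equivalently, connected and acyclic). *)
Definition spanning_tree (n : nat) (G T : rel 'I_n) : Prop :=
  simple_graph T /\ subgraph T G /\ connected_graph T /\ num_edges T = n.-1.

Definition evec (R : realFieldType) (n : nat) (u : 'I_n) : 'cV[R]_n :=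
  \col_(i < n) (i == u)%:R.

Definition bvec (R : realFieldType) (n : nat) (u v : 'I_n) : 'cV[R]_n :=
  evec R u - evec R v.

Definition laplacian (R : realFieldType) (n : nat) (H : rel 'I_n) : 'M[R]_n :=
  \sum_(u < n) \sum_(v < n | (u < v)%N && H u v) (bvec R u v *m (bvec R u v)^T).

Definition is_pinv (R : realFieldType) (n : nat) (A X : 'M[R]_n) : Prop :=
  [/\ A *m X *m A = A, X *m A *m X = X, (A *m X)^T = A *m X & (X *m A)^T = X *m A].

(* Effective resistance of uv given the pseudoinverse X of L_G. *)
Definition eff_res (R : realFieldType) (n : nat) (X : 'M[R]_n) (u v : 'I_n) : R :=
  ((bvec R u v)^T *m X *m bvec R u v) 0 0.

Definition loewner_le (R : realFieldType) (n : nat) (A B : 'M[R]_n) : Prop :=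
  forall x : 'cV[R]_n, 0 <= (x^T *m (B - A) *m x) 0 0.

(* Main.v *)
Require Import Defs.
From HB Require Import structures.
From mathcomp Require Import all_boot all_order all_algebra.
From mathcomp Require Import complex ring lra.
From Stdlib Require Import FunctionalExtensionality.
Import Order.TTheory GRing.Theory Num.Theory.
Local Open Scope ring_scope.
Set Implicit Arguments. Unset Strict Implicit. Unset Printing Implicit Defensive.

(** Let [a_e] be the edge vectors, [J] the averaging matrix and
    [D z = det (sum_e z_e a_e a_e^T + J)], a multiple of the spanning tree
    polynomial. Applying all the operators [1 - eta d/dz_e d/dw_e] to [D z * D w]
    yields, up to scaling, the expected characteristic polynomial of
    [sum_(e in T) a_e a_e^T] (relative to [L_G]) for a uniform spanning tree [T], as
    in the work of Anari and Oveis Gharan on strongly Rayleigh measures. Both the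
    marginals and the squared norms of the edges are the effective resistances,
    hence at most [1 / kappa], and a barrier argument started at the point [1]
    shows for [eta = kappa / 2] that the result is positive at all [z, w >= 2].
    Positivity on this orthant survives a suitable choice, edge by edge, between
    deletion ([w_e = 0]) and contraction ([d/dw_e], with a shift of [z_e]); this is
    the interlacing step. When every edge has been treated one is left with a
    positive multiple of [D (z - (eta / 2) 1_T)], and its positivity for all
    [z >= 2] means that [2 L_G - (kappa / 4) L_T] is positive semidefinite.

    All polynomials involved are multiaffine, so stability is only used through
    the Rayleigh inequality [f d_i d_j f <= d_i f d_j f] at real points. The weight
    [eta] replaces the symmetric rescaling by [sqrt kappa], which need not exist in
    the field [R]. *)

(** * Multiaffine functions *)

Section Multiaffine.
Variables (K : comNzRingType) (V : finType).
Implicit Types (F : {ffun V -> K} -> K) (z : {ffun V -> K}) (i j : V).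

Definition upd z i a : {ffun V -> K} := [ffun j => if j == i then a else z j].

(** On functions affine in each coordinate this difference is the partial derivative, so bare
    functions can stand in for polynomials. *)
Definition partial F i z := F (upd z i 1) - F (upd z i 0).

Definition multiaffine F :=
  forall z i a, F (upd z i a) = F (upd z i 0) + a * partial F i z.

Lemma upd_upd z i a b : upd (upd z i a) i b = upd z i b.
Proof. by apply/ffunP=> k; rewrite !ffunE; case: eqP. Qed.

Lemma updC z i j a b : i != j -> upd (upd z i a) j b = upd (upd z j b) i a.
Proof.
move=> ij; apply/ffunP=> k; rewrite !ffunE.
by case: (k =P j) => // ->; rewrite eq_sym (negPf ij).
Qed.

Lemma upd_id z i : upd z i (z i) = z.
Proof. by apply/ffunP=> k; rewrite !ffunE; case: eqP => // ->. Qed.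

Lemma upd_eq z i a : upd z i a i = a.
Proof. by rewrite ffunE eqxx. Qed.

Lemma upd_neq z i j a : i != j -> upd z i a j = z j.
Proof. by rewrite ffunE eq_sym => /negPf ->. Qed.

Lemma partial_upd F i z a : partial F i (upd z i a) = partial F i z.
Proof. by rewrite /partial !upd_upd. Qed.

Lemma partial_partial F i z : partial (partial F i) i z = 0.
Proof. by rewrite {1}/partial !partial_upd subrr. Qed.

Lemma partial_updN F i j z a : i != j ->
  partial F i (upd z j a) = partial (fun y => F (upd y j a)) i z.
Proof. by move=> ij; rewrite /partial !(updC _ _ _ ij). Qed.

Lemma partialC F i j z :
  partial (partial F i) j z = partial (partial F j) i z.
Proof.
have [->//|ij] := eqVneq i j.
by rewrite /partial !(updC _ _ _ ij); ring.
Qed.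

Lemma multiaffine_upd F z i t : multiaffine F ->
  F (upd z i t) = F z + (t - z i) * partial F i z.
Proof.
by move=> mF; rewrite mF -[in F z](upd_id z i) (mF z i (z i)) mulrBl; ring.
Qed.

Lemma multiaffine_add F z i t : multiaffine F ->
  F (upd z i (z i + t)) = F z + t * partial F i z.
Proof. by move=> mF; rewrite multiaffine_upd // addrAC subrr add0r. Qed.

Lemma multiaffine_partial F i : multiaffine F -> multiaffine (partial F i).
Proof.
move=> mF z j a; have [->|ij] := eqVneq j i.
  by rewrite partial_partial mulr0 addr0 !partial_upd.
have E b : partial F i (upd z j b) = F (upd (upd z i 1) j b) - F (upd (upd z i 0) j b).
  by rewrite /partial !(updC _ _ _ ij).
have -> : partial (partial F i) j z =
    partial F i (upd z j 1) - partial F i (upd z j 0) by [].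
rewrite !E.
by rewrite (mF (upd z i 1) j a) (mF (upd z i 0) j a) /partial; ring.
Qed.

(** The operator [1 - eta d_i d_j] of Lieb and Sokal, which preserves stability for [eta > 0] and
    [i != j]. *)
Definition lieb_sokal (eta : K) i j F z := F z - eta * partial (partial F i) j z.

Lemma partial_lieb_sokal eta i j F k z : partial (lieb_sokal eta i j F) k z =
  partial F k z - eta * partial (partial (partial F i) j) k z.
Proof.
rewrite /lieb_sokal; move: (partial (partial F i) j) => G.
by rewrite /partial; ring.
Qed.

Lemma multiaffine_lieb_sokal eta i j F :
  multiaffine F -> multiaffine (lieb_sokal eta i j F).
Proof.
move=> mF z k a.
have mG := multiaffine_partial j (multiaffine_partial i mF).
rewrite partial_lieb_sokal /lieb_sokal (mF z k a) (mG z k a); ring.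
Qed.

Lemma partial_restrict_eq F i a z : partial (fun y => F (upd y i a)) i z = 0.
Proof. by rewrite /partial !upd_upd subrr. Qed.

Lemma partial_shift F i k s z : multiaffine F ->
  partial (fun y => F (upd y i (y i - s))) k z = partial F k (upd z i (z i - s)).
Proof.
move=> mF; have [->|ki] := eqVneq k i; rewrite {1}/partial.
  by rewrite !upd_upd !upd_eq !(mF _ _ (_ - _)) partial_upd; ring.
by rewrite !upd_neq // !(updC _ _ _ ki).
Qed.

Lemma multiaffine_restrict F i b :
  multiaffine F -> multiaffine (fun y => F (upd y i b)).
Proof.
move=> mF z k a; have [->|ki] := eqVneq k i.
  by rewrite partial_restrict_eq !upd_upd mulr0 addr0.
by rewrite -partial_updN // !(updC _ _ _ ki) (mF _ k a).
Qed.

Lemma multiaffine_shift F i s :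
  multiaffine F -> multiaffine (fun y => F (upd y i (y i - s))).
Proof.
move=> mF z k a; rewrite partial_shift //.
have [->|ki] := eqVneq k i.
  by rewrite !upd_upd !upd_eq partial_upd !(mF _ i (_ - _)); ring.
by rewrite !upd_neq // !(updC _ _ _ ki) (mF _ k a).
Qed.

End Multiaffine.

(** * Stability *)

Section Stability.
Local Open Scope complex_scope.
Local Notation Re := complex.Re.
Local Notation Im := complex.Im.
Variables (R : realFieldType) (V : finType).
Local Notation C := R[i].
Implicit Types (F : {ffun V -> C} -> C) (z : {ffun V -> C}) (x y : C).

Lemma quadratic_le0_lead (a b c : R) :
  (forall t, a + b * t + c * t ^+ 2 <= 0) -> c <= 0.
Proof.
move=> H; rewrite leNgt; apply/negP => c0.
(* As [c t = |a| + c] and [t >= 1], one has [a + c t^2 > 0]; averaging the values at [t] and [- t]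
   removes the linear term. *)
set t := `|a| / c + 1.
have t1 : 1 <= t by rewrite lerDr divr_ge0 // ltW.
have ct : c * t = `|a| + c by rewrite /t; field; rewrite gt_eqF.
have := ler_norm (- a); rewrite normrN => na.
have h : a + c * t * t <= 0 by have := H t; have := H (- t); nra.
have : (`|a| + c) * 1 <= (`|a| + c) * t by rewrite ler_wpM2l // addr_ge0 // ltW.
rewrite -ct; lra.
Qed.

(** Replaces letting [t] tend to [0] over an ordered field: if [a > 0], then at [t = a / (2 d)] the
    two higher terms amount to at most [a / 2]. *)
Lemma quadratic_le0_at0 (a b c : R) :
  (forall t, 0 < t -> a + b * t + c * t ^+ 2 <= 0) -> a <= 0.
Proof.
move=> H; rewrite leNgt; apply/negP => a0.
set d := a + `|b| + `|c|.
have d0 : 0 < d by rewrite /d -addrA ltr_pwDl // addr_ge0.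
have dV : d != 0 by rewrite gt_eqF.
have t0 : 0 < a / d by rewrite divr_gt0.
have ht : a / d <= 1 by rewrite ler_pdivrMr // mul1r /d -addrA lerDl addr_ge0.
have := H _ (divr_gt0 t0 (ltr0n R 2)).
have e : a = a / d * (a + `|b| + `|c|) by rewrite -/d; field.
move: t0 ht e; set t := a / d => t0 ht e.
have hb := ler_norm (- b); rewrite normrN in hb.
have hc := ler_norm (- c); rewrite normrN in hc.
have := normr_ge0 b; have := normr_ge0 c.
move: hb hc e; move: (`|b|) (`|c|) => k l hb hc e l0 k0.
rewrite leNgt => /negP; apply; nra.
Qed.

(* The imaginary part of [x * conj y]. *)
Definition imdot x y : R := Im x * Re y - Re x * Im y.

Lemma cReD x y : Re (x + y) = Re x + Re y. Proof. by case: x; case: y. Qed.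
Lemma cImD x y : Im (x + y) = Im x + Im y. Proof. by case: x; case: y. Qed.
Lemma cReN x : Re (- x) = - Re x. Proof. by case: x. Qed.
Lemma cImN x : Im (- x) = - Im x. Proof. by case: x. Qed.
Lemma cReM x y : Re (x * y) = Re x * Re y - Im x * Im y.
Proof. by case: x; case: y. Qed.
Lemma cImM x y : Im (x * y) = Re x * Im y + Im x * Re y.
Proof. by case: x; case: y. Qed.

Definition ReImE := (cReD, cImD, cReN, cImN, cReM, cImM).

Lemma complex_eq0 x : Re x = 0 -> Im x = 0 -> x = 0.
Proof. by case: x => a b /= -> ->. Qed.

Definition upper_closed z := forall j, 0 <= Im (z j).

(* For a multiaffine [F] this is stability (no zero with all coordinates in the
   open upper half plane), made a closed condition: it also holds of the zero
   polynomial, so deletion and differentiation need no case distinction. *)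
Definition stable_cplx F :=
  forall z i, upper_closed z -> imdot (partial F i z) (F z) <= 0.

Lemma upper_closed_upd z i x :
  upper_closed z -> 0 <= Im x -> upper_closed (upd z i x).
Proof. by move=> uz x0 j; rewrite ffunE; case: eqP. Qed.

(** Lowering [z i] to its real part adds [Im (z i) * |d_i F|^2] to [imdot], and stability still
    bounds the result by [0]. *)
Lemma imdot_strict F z i : multiaffine F -> stable_cplx F ->
  upper_closed z -> 0 < Im (z i) -> 0 <= imdot (partial F i z) (F z) ->
  partial F i z = 0.
Proof.
move=> mF sF uz zi h.
have := sF _ i (upper_closed_upd i uz (lexx (Im (Re (z i))%:C))).
rewrite partial_upd (multiaffine_upd _ _ _ mF) => h2.
have : Re (partial F i z) ^+ 2 + Im (partial F i z) ^+ 2 <= 0.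
  by move: h2 h; rewrite /imdot !ReImE /=; nra.
move=> h3; apply: complex_eq0; apply/eqP; rewrite -sqrf_eq0 eq_le sqr_ge0 andbT;
  nra.
Qed.

(** For real [z i = t] the stability bound in direction [j] is a quadratic in [t], whose leading
    coefficient is the quantity to bound for [d_i F]. *)
Lemma stable_cplx_partial F i : multiaffine F -> stable_cplx F ->
  stable_cplx (partial F i).
Proof.
move=> mF sF z j uz.
have [->|ij] := eqVneq j i.
  by rewrite partial_partial /imdot !mul0r subrr.
rewrite partialC.
have mG := multiaffine_partial j mF.
apply: (@quadratic_le0_lead (imdot (partial F j (upd z i 0)) (F (upd z i 0)))
  (imdot (partial (partial F j) i z) (F (upd z i 0)) +
   imdot (partial F j (upd z i 0)) (partial F i z))) => t.
have := sF _ j (upper_closed_upd i uz (lexx (Im t%:C))).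
rewrite (mG z i) (mF z i) /imdot !ReImE /=; nra.
Qed.

Lemma stable_cplx_restrict F i (a : R) : multiaffine F -> stable_cplx F ->
  stable_cplx (fun z => F (upd z i a%:C)).
Proof.
move=> mF sF z j uz; have [->|ij] := eqVneq j i.
  by rewrite partial_restrict_eq /imdot !mul0r subrr.
by rewrite -partial_updN //; apply: sF; apply: upper_closed_upd.
Qed.

Lemma stable_cplx_shift F i (s : R) : multiaffine F -> stable_cplx F ->
  stable_cplx (fun z => F (upd z i (z i - s%:C))).
Proof.
move=> mF sF z j uz; rewrite partial_shift //; apply: sF.
by apply: upper_closed_upd => //; rewrite !ReImE /= subr0.
Qed.

End Stability.

(** * Preservation of stability by the Lieb-Sokal operators *)

Section LiebSokal.
Local Open Scope complex_scope.
Local Notation Re := complex.Re.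
Local Notation Im := complex.Im.
Variables (R : realFieldType) (V : finType).
Local Notation C := R[i].
Implicit Types (F G : {ffun V -> C} -> C) (z : {ffun V -> C}) (x y : C).

Lemma lieb_sokalC (eta : C) i j F : lieb_sokal eta i j F = lieb_sokal eta j i F.
Proof. by apply: functional_extensionality => z; rewrite /lieb_sokal partialC. Qed.

(** Since [d_i d_i F = 0], the left side is [imdot (d_i F) F + eta * imdot (d_j d_i F) (d_i F)],
    bounded by the stability of [F] and of [d_i F]. *)
Lemma stable_cplx_lieb_sokal_own (eta : R) i j F z : 0 < eta ->
  multiaffine F -> stable_cplx F -> upper_closed z ->
  imdot (partial (lieb_sokal eta%:C i j F) i z) (lieb_sokal eta%:C i j F z) <= 0.
Proof.
move=> eta0 mF sF uz; have h1 := sF _ i uz.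
have h2 := stable_cplx_partial i mF sF j uz.
have e0 : partial (partial (partial F i) j) i z = 0.
  have E : partial (partial F i) i = fun=> 0.
    by apply: functional_extensionality => y; exact: partial_partial.
  by rewrite partialC E; exact: subrr.
rewrite partial_lieb_sokal e0 mulr0 subr0 /lieb_sokal.
by move: h1 h2; rewrite /imdot !ReImE /=; nra.
Qed.

(** The zero [s = - w] of [x + s * y] lies in the open upper half plane. *)
Lemma root_above x y : 0 < imdot y x ->
  exists w : C, [/\ y * w = x & Im w < 0].
Proof.
move=> h; have y0 : y != 0.
  by apply: contraTneq h => ->; rewrite /imdot !mul0r subrr ltxx.
exists (x / y); split; first by rewrite mulrC divfK.
have e : x = y * (x / y) by rewrite mulrC divfK.
move: h; rewrite {1}e; move: (x / y) => w; rewrite /imdot !ReImE.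
case: y {e} y0 => a b; case: w => u v /= _ h; nra.
Qed.

(* If the bound failed, moving [z k] further up would reach a zero of the new
   polynomial; there the own-variable bounds are tight, which forces the new
   polynomial to be constant in [z k]. *)
Lemma stable_cplx_lieb_sokal_open (eta : R) i j k F z : 0 < eta ->
  multiaffine F -> stable_cplx F -> upper_closed z -> i != j -> k != i -> k != j ->
  0 < Im (z i) -> 0 < Im (z j) ->
  imdot (partial (lieb_sokal eta%:C i j F) k z) (lieb_sokal eta%:C i j F z) <= 0.
Proof.
move=> eta0 mF sF uz ij ki kj zi zj; rewrite leNgt; apply/negP => h.
have mG := multiaffine_lieb_sokal eta%:C i j mF.
have [w [dw w0]] := root_above h.
set G := lieb_sokal eta%:C i j F in mG h dw.
set y := upd z k (z k - w).
have yk : 0 < Im (y k).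
  by rewrite upd_eq !ReImE subr_gt0 (lt_le_trans w0).
have uy : upper_closed y.
  by apply: upper_closed_upd => //; rewrite -[z k - w](upd_eq z k) ltW.
have yi : y i = z i by rewrite upd_neq.
have yj : y j = z j by rewrite upd_neq.
have Gy : G y = 0.
  by rewrite (multiaffine_upd _ _ _ mG) -dw; ring.
have Fd : F y = eta%:C * partial (partial F i) j y.
  by apply/eqP; rewrite -subr_eq0; apply/eqP.
have mFi := multiaffine_partial i mF; have sFi := stable_cplx_partial i mF sF.
have sFij := stable_cplx_partial j mFi sFi; have mFij := multiaffine_partial j mFi.
have h2 := sFi _ j uy.
(* Here [F = eta d_i d_j F], so stability of [d_i F] in direction [j] gives [imdot (d_i F) F >= 0],
   opposite to the bound from [F] itself. *)
have Fi0 : partial F i y = 0.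
  apply: imdot_strict => //; first by rewrite yi.
  by rewrite Fd; move: h2; rewrite /imdot !ReImE /=; nra.
have d0 : partial (partial F i) j y = 0.
  by apply: imdot_strict => //; rewrite ?yj // Fi0 /imdot !mulr0 subrr.
have F0 : F y = 0 by rewrite Fd d0 mulr0.
have Fk0 : partial F k y = 0.
  by apply: imdot_strict => //; rewrite F0 /imdot !mulr0 subrr.
have dk0 : partial (partial (partial F i) j) k y = 0.
  by apply: imdot_strict => //; rewrite d0 /imdot !mulr0 subrr.
move: h; rewrite -(partial_upd G k z (z k - w)) -/y partial_lieb_sokal Fk0 dk0.
by rewrite mulr0 subr0 /imdot !mul0r subrr ltxx.
Qed.

(** The quantity is quadratic in [t], so [quadratic_le0_at0] plays the role of the limit. *)
Lemma imdot_limit F G i z : multiaffine F -> multiaffine G ->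
  (forall t : R, 0 < t ->
     imdot (F (upd z i (z i + (0 +i* t)))) (G (upd z i (z i + (0 +i* t)))) <= 0) ->
  imdot (F z) (G z) <= 0.
Proof.
move=> mF mG h; apply: (@quadratic_le0_at0 _ _
  (imdot ((0 +i* 1) * partial F i z) (G z) + imdot (F z) ((0 +i* 1) * partial G i z))
  (imdot ((0 +i* 1) * partial F i z) ((0 +i* 1) * partial G i z))) => t t0.
have := h t t0; rewrite !multiaffine_upd // addrAC subrr add0r.
by rewrite /imdot !ReImE /=; nra.
Qed.

Lemma stable_cplx_lieb_sokal (eta : R) i j F : 0 < eta -> i != j ->
  multiaffine F -> stable_cplx F -> stable_cplx (lieb_sokal eta%:C i j F).
Proof.
move=> eta0 ij mF sF z k uz.
have [->|ki] := eqVneq k i; first exact: stable_cplx_lieb_sokal_own.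
have [->|kj] := eqVneq k j.
  by rewrite lieb_sokalC; apply: stable_cplx_lieb_sokal_own.
have mG := multiaffine_lieb_sokal eta%:C i j mF.
have mGk := multiaffine_partial k mG.
have up (y : {ffun V -> C}) l (t : R) : upper_closed y -> 0 < t ->
    upper_closed (upd y l (y l + (0 +i* t))) /\ 0 < Im (y l + (0 +i* t)).
  move=> uy t0; have : 0 < Im (y l + (0 +i* t)).
    by rewrite !ReImE /= ltr_wpDl.
  by move=> p; split=> //; apply: upper_closed_upd => //; apply: ltW.
(* The open case needs [z i] and [z j] strictly above the real axis: both are raised, and two limits
   undo this. *)
apply: (@imdot_limit _ _ i) => // t t0.
apply: (@imdot_limit _ _ j) => // s s0.
have [u1 p1] := up z i t uz t0.
have [u2 p2] := up _ j s u1 s0.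
apply: stable_cplx_lieb_sokal_open => //; last by rewrite upd_eq.
by rewrite upd_neq 1?eq_sym // upd_eq.
Qed.

End LiebSokal.

(** * Real stable functions and the Rayleigh inequality *)

Section RealStable.
Local Open Scope complex_scope.
Local Notation Re := complex.Re.
Local Notation Im := complex.Im.
Variables (R : realFieldType) (V : finType).
Implicit Types (f : {ffun V -> R} -> R) (r p : {ffun V -> R}).

Definition embed r : {ffun V -> R[i]} := [ffun i => (r i)%:C].

(** A bare real function has no coefficients to read over the complex numbers, so a complex
    multiaffine extension is asked for. *)
Definition stable f := multiaffine f /\
  exists F, [/\ multiaffine F, stable_cplx F & forall r, F (embed r) = (f r)%:C].

Lemma embed_upd r i a : embed (upd r i a) = upd (embed r) i a%:C.
Proof. by apply/ffunP=> k; rewrite !ffunE; case: eqP. Qed.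

Lemma partial_embed f F i :
  (forall r, F (embed r) = (f r)%:C) ->
  forall r, partial F i (embed r) = (partial f i r)%:C.
Proof.
move=> h r; rewrite /partial -[upd _ _ 1]/(upd (embed r) i 1%:C).
by rewrite -[upd _ _ 0]/(upd (embed r) i 0%:C) -!embed_upd !h rmorphB.
Qed.

Lemma stable_partial f i : stable f -> stable (partial f i).
Proof.
move=> [mf [F [mF sF h]]]; split; first exact: multiaffine_partial.
exists (partial F i); split; first exact: multiaffine_partial.
  exact: stable_cplx_partial.
exact: partial_embed.
Qed.

Lemma stable_restrict f i a : stable f -> stable (fun r => f (upd r i a)).
Proof.
move=> [mf [F [mF sF h]]]; split; first exact: multiaffine_restrict.
exists (fun z => F (upd z i a%:C)); split; first exact: multiaffine_restrict.
  exact: stable_cplx_restrict.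
by move=> r; rewrite -embed_upd h.
Qed.

Lemma stable_shift f i s : stable f -> stable (fun r => f (upd r i (r i - s))).
Proof.
move=> [mf [F [mF sF h]]]; split; first exact: multiaffine_shift.
exists (fun z => F (upd z i (z i - s%:C))); split.
- exact: multiaffine_shift.
- exact: stable_cplx_shift.
by move=> r; rewrite ffunE -rmorphB -embed_upd h.
Qed.

Lemma stable_lieb_sokal eta f i j : 0 < eta -> i != j ->
  stable f -> stable (lieb_sokal eta i j f).
Proof.
move=> eta0 ij [mf [F [mF sF h]]]; split; first exact: multiaffine_lieb_sokal.
exists (lieb_sokal eta%:C i j F); split; first exact: multiaffine_lieb_sokal.
  exact: stable_cplx_lieb_sokal.
move=> r; rewrite /lieb_sokal h (partial_embed _ (partial_embed _ h)).
have E (a b : R) : (a * b)%:C = a%:C * b%:C.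
  by apply/eqP; rewrite eq_complex !ReImE /= !mul0r mulr0 subr0 addr0 !eqxx.
by rewrite -E rmorphB.
Qed.

(** Stability in direction [j] at [r] with the imaginary unit added to coordinate [i]: the imaginary
    part there is [f d_i d_j f - d_i f d_j f]. *)
Lemma rayleigh f i j r : stable f -> i != j ->
  f r * partial (partial f i) j r <= partial f i r * partial f j r.
Proof.
move=> [mf [F [mF sF h]]] ij.
have := sF (upd (embed r) i ((r i)%:C + (0 +i* 1))) j.
rewrite !multiaffine_upd //; last exact: multiaffine_partial.
rewrite [partial (partial F j) i _]partialC.
rewrite (partial_embed _ (partial_embed _ h)) !(partial_embed _ h) h ffunE.
rewrite addrAC subrr add0r.
rewrite /imdot !ReImE /= => H.
suff : forall k, 0 <= Im (upd (embed r) i ((r i)%:C + (0 +i* 1)) k).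
  by move=> /H; nra.
by move=> k; rewrite !ffunE; case: ifP; rewrite ?ReImE //= add0r.
Qed.

Definition above p r := forall i, p i <= r i.

Definition pos_above p f := forall r, above p r -> 0 < f r.

Lemma above_refl p : above p p. Proof. by move=> i. Qed.

Lemma above_add p r i t : above p r -> 0 <= t -> above p (upd r i (r i + t)).
Proof.
move=> pr t0 k; rewrite ffunE; case: eqP => // ->.
by rewrite (le_trans (pr i)) // lerDl.
Qed.

Lemma above_ind p (P : {ffun V -> R} -> Prop) : P p ->
  (forall r i t, above p r -> 0 <= t -> P r -> P (upd r i (r i + t))) ->
  forall r, above p r -> P r.
Proof.
move=> Pp step r pr.
pose q (s : seq V) : {ffun V -> R} := [ffun i => if i \in s then r i else p i].
have aq s : above p (q s) by move=> i; rewrite ffunE; case: ifP.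
have Pq : forall s, P (q s).
  elim=> [|i s IH]; first by rewrite (_ : q [::] = p) //; apply/ffunP=> i; rewrite ffunE.
  have -> : q (i :: s) = upd (q s) i (q s i + (r i - q s i)).
    by apply/ffunP=> k; rewrite !ffunE inE; case: eqP => [->|//]; rewrite addrC subrK.
  apply: step => //; rewrite subr_ge0 ffunE; case: ifP => // _; exact: pr.
by rewrite (_ : r = q (enum V)) //; apply/ffunP=> i; rewrite ffunE mem_enum.
Qed.

Lemma partial_ge0 f p i : multiaffine f -> (forall r, above p r -> 0 <= f r) ->
  forall r, above p r -> 0 <= partial f i r.
Proof.
move=> mf h r pr; rewrite leNgt; apply/negP => d0.
have hr := h _ pr.
(* After this step in coordinate [i] the function would take the value [-1]. *)
have t0 : 0 <= (f r + 1) / - partial f i r.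
  by rewrite divr_ge0 ?addr_ge0 ?oppr_ge0 // ltW.
have := h _ (above_add i pr t0).
rewrite multiaffine_add // invrN mulrN mulNr divfK ?lt_eqF //.
by rewrite opprD addNKr oppr_ge0 ler10.
Qed.

(** By the Rayleigh inequality [d_j f / f] is nonincreasing in every coordinate, so its bound at the
    corner holds on the orthant. *)
Lemma log_partial_le f p j b : stable f -> 0 <= b -> pos_above p f ->
  partial f j p <= b * f p ->
  forall r, above p r -> partial f j r <= b * f r.
Proof.
move=> sf b0 pf hp; have [mf _] := sf.
have wf r : above p r -> 0 <= f r by move=> /pf/ltW.
apply: above_ind => // r i t pr t0 IH.
have fi0 := partial_ge0 i mf wf pr.
rewrite (multiaffine_add _ _ _ mf).
have bt := mulr_ge0 b0 (mulr_ge0 t0 fi0).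
have [ij|ij] := eqVneq i j; first by subst j; rewrite partial_upd; nra.
rewrite multiaffine_add; last exact: multiaffine_partial.
have h := rayleigh r sf ij; have fr := pf r pr.
have : partial (partial f j) i r <= b * partial f i r.
  rewrite -(ler_pM2l fr) partialC; apply: le_trans h _; nra.
nra.
Qed.

End RealStable.

(** * The barrier argument *)

Section Barrier.
Variables (R : realFieldType) (V : finType).
Implicit Types (f : {ffun V -> R} -> R) (r p : {ffun V -> R}) (a b j : V).

Lemma discriminant_le (W X Y : R) :
  (forall h, 0 <= W + 2 * X * h + Y * h ^+ 2) -> X ^+ 2 <= W * Y.
Proof.
move=> H; have Y0 : 0 <= Y.
  rewrite -oppr_le0; apply: (@quadratic_le0_lead _ (- W) (- (2 * X))) => t.
  by have := H t; nra.
have [Y1|Yn] := eqVneq Y 0.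
  have [->|X1] := eqVneq X 0; first by rewrite Y1 mulr0 expr0n.
  have := H (- (W + 1) / (2 * X)).
  have -> : W + 2 * X * (- (W + 1) / (2 * X)) + Y * (- (W + 1) / (2 * X)) ^+ 2 = -1.
    by rewrite Y1; field.
  by rewrite ler0N1.
have := H (- X / Y).
have -> : W + 2 * X * (- X / Y) + Y * (- X / Y) ^+ 2 = (W * Y - X ^+ 2) / Y by field.
by rewrite pmulr_lge0 ?subr_ge0 // invr_gt0 lt_def Yn.
Qed.

(* With [p h = P + P1 h + c h^2] the polynomial and [q h = B + B1 h + cB h^2] its
   partial derivative along the line, the claim is
   [(q - eta q''/2) / (p - eta p''/2) <= q(-1) / p(-1)] at [h = 0]. *)
Lemma barrier_ineq (eta P P1 c B B1 cB : R) :
  0 < eta -> 0 < P -> 0 <= c -> 0 < P - eta * c -> eta * P1 <= P ->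
  (forall h, -1 <= h <= 0 -> 0 < P + P1 * h + c * h ^+ 2) ->
  (forall h, 0 <= (B * P1 - B1 * P) + 2 * (B * c - cB * P) * h +
                  (B1 * c - cB * P1) * h ^+ 2) ->
  (B - eta * cB) * (P - P1 + c) <= (B - B1 + cB) * (P - eta * c).
Proof.
move=> eta0 P0 c0 Pc hP1 hpos hW.
(* [W] and [X] come from the Wronskian [q p' - q' p = W + 2 X h + Y h^2], nonnegative by [hW]. *)
set W := B * P1 - B1 * P; set X := B * c - cB * P.
have eP := mulr_gt0 eta0 P0.
have W0 : 0 <= W by have := hW 0; rewrite -/W !mulr0 expr0n mulr0 !addr0.
(* The discriminant bound [X^2 <= W Y] multiplied by [P], with [P Y = P1 X - c W]. *)
have disc : P * X ^+ 2 <= W * (P1 * X - c * W).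
  have := discriminant_le hW; rewrite -/W -/X -(ler_pM2l P0).
  by congr (_ <= _); rewrite /W /X; ring.
rewrite -subr_ge0 -(pmulr_rge0 _ P0).
have -> : P * ((B - B1 + cB) * (P - eta * c) - (B - eta * cB) * (P - P1 + c)) =
  (P - eta * c) * W + (eta * P1 - (1 + eta) * P) * X by rewrite /W /X; ring.
have [X0|X0] := lerP X 0.
  have h1 := mulr_ge0 (ltW Pc) W0.
  have h2 : (eta * P1 - (1 + eta) * P) * X >= 0 by apply: mulr_le0 => //; nra.
  exact: addr_ge0.
have W1 : 0 < W.
  rewrite lt_def W0 andbT; apply: contraTneq disc => ->.
  by rewrite mul0r -ltNge mulr_gt0 // exprn_gt0.
have cW : 0 <= c * W ^+ 2 by rewrite mulr_ge0 // sqr_ge0.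
have PX : P * X <= P1 * W by rewrite -(ler_pM2r X0); nra.
have eX : eta * X <= W.
  rewrite -(ler_pM2l P0); apply: (@le_trans _ _ (eta * P1 * W)); last by nra.
  by nra.
have XW : X <= W.
  (* Otherwise [h = - W / X] lies in [[-1, 0]], where [disc] makes [p h] nonpositive. *)
  rewrite leNgt; apply/negP => WX.
  have Xn : X != 0 by rewrite gt_eqF.
  have h1 : -1 <= - (W / X) by rewrite lerN2 ler_pdivrMr // mul1r ltW.
  have h2 : - (W / X) <= 0 by rewrite oppr_le0 divr_ge0 // ltW.
  have := hpos (- (W / X)); rewrite h1 h2 => /(_ isT).
  rewrite -(pmulr_rgt0 _ (exprn_gt0 2 X0)).
  have -> : X ^+ 2 * (P + P1 * - (W / X) + c * (- (W / X)) ^+ 2) =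
    P * X ^+ 2 - W * (P1 * X - c * W) by field.
  by rewrite subr_gt0 ltNge disc.
rewrite -(pmulr_rge0 _ W1).
(* By [disc], [W] times the remaining expression is at least [P (W - X) (W - eta X)]. *)
apply: (@le_trans _ _ (P * ((W - X) * (W - eta * X)))).
  by apply: mulr_ge0; [exact: ltW | apply: mulr_ge0; rewrite subr_ge0].
nra.
Qed.

Definition diag a b r (h : R) := upd (upd r a (r a + h)) b (r b + h).

Lemma multiaffine_diag f a b r h : multiaffine f -> a != b ->
  f (diag a b r h) =
  f r + (partial f a r + partial f b r) * h + partial (partial f a) b r * h ^+ 2.
Proof.
move=> mf ab; rewrite /diag -[r b](upd_neq r (r a + h) ab) multiaffine_add //.
rewrite !multiaffine_add //; last exact: multiaffine_partial.
rewrite [partial (partial f b) a r]partialC; ring.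
Qed.

Lemma partial_diag_l f a b r h : multiaffine f -> a != b ->
  partial f a (diag a b r h) = partial f a r + partial (partial f a) b r * h.
Proof.
move=> mf ab; rewrite /diag -[r b](upd_neq r (r a + h) ab).
rewrite multiaffine_add; last exact: multiaffine_partial.
by rewrite partial_upd partialC partial_upd partialC mulrC.
Qed.

Lemma partial_diag_r f a b r h : multiaffine f -> a != b ->
  partial f b (diag a b r h) = partial f b r + partial (partial f a) b r * h.
Proof.
move=> mf ab; rewrite /diag partial_upd multiaffine_add; last exact: multiaffine_partial.
by rewrite partialC mulrC.
Qed.

Lemma above_diag p a b r h : above p r -> 0 <= h -> above p (diag a b r h).
Proof.
move=> pr h0 k; rewrite !ffunE; case: eqP => [->|_].
  by apply: le_trans (pr b) _; rewrite lerDl.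
by case: eqP => [->|_]; [apply: le_trans (pr a) _; rewrite lerDl | apply: pr].
Qed.

Lemma diagK a b r h k : a != b -> diag a b (diag a b r h) k = diag a b r (h + k).
Proof.
move=> ab; apply/ffunP=> l; rewrite !ffunE eqxx (negPf ab) eqxx.
by case: eqP => // _; rewrite ?addrA //; case: eqP => // _; rewrite addrA.
Qed.

Lemma partial2_ge0 f p i j : multiaffine f -> pos_above p f ->
  forall r, above p r -> 0 <= partial (partial f i) j r.
Proof.
move=> mf pf; apply: partial_ge0; first exact: multiaffine_partial.
by apply: partial_ge0 => // r /pf/ltW.
Qed.

(** Rayleigh and the bounds at [a] and [b] give [eta d_a d_b f <= eta beta^2 f < f], hence
    positivity. Raising both coordinates by [1] offsets the effect of the operator on the other
    logarithmic derivatives; [2 eta beta <= 1] yields the hypothesis [eta * P1 <= P] of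
    [barrier_ineq]. *)
Lemma barrier_step f p a b (eta beta : R) : stable f -> a != b -> pos_above p f ->
  0 < eta -> 0 < beta -> eta * beta ^+ 2 < 1 -> 2 * eta * beta <= 1 ->
  partial f a p <= beta * f p -> partial f b p <= beta * f p ->
  pos_above (diag a b p 1) (lieb_sokal eta a b f) /\
  forall j, j != a -> j != b -> partial f j p <= beta * f p ->
    partial (lieb_sokal eta a b f) j (diag a b p 1) <=
    beta * lieb_sokal eta a b f (diag a b p 1).
Proof.
move=> sf ab pf eta0 beta0 eb1 eb2 fa fb; have [mf _] := sf.
have b0 := ltW beta0.
have fa' := log_partial_le sf b0 pf fa; have fb' := log_partial_le sf b0 pf fb.
have wf r : above p r -> 0 <= f r by move=> /pf/ltW.
have pos r : above p r -> 0 < lieb_sokal eta a b f r.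
  move=> pr; have fr := pf r pr; rewrite -(pmulr_rgt0 _ fr) /lieb_sokal.
  have h := rayleigh r sf ab.
  have h2 : partial f a r * partial f b r <= (beta * f r) ^+ 2.
    by rewrite expr2 ler_pM ?fa' ?fb' // (partial_ge0 _ mf wf).
  have : eta * (f r * partial (partial f a) b r) <= eta * beta ^+ 2 * f r ^+ 2.
    rewrite -mulrA ler_pM2l // -exprMn; exact: le_trans h h2.
  have := exprn_gt0 2 fr; nra.
set q := diag a b p 1.
have pq : above p q by apply: above_diag => //; exact: above_refl.
split=> [r qr|j ja jb fj].
  by apply: pos => k; apply: le_trans (pq k) (qr k).
have mj := multiaffine_partial j mf.
have back h : -1 <= h -> above p (diag a b q h).
  move=> h1; rewrite diagK //; apply: above_diag; first exact: above_refl.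
  by rewrite -lerBlDl sub0r.
have q_back : p = diag a b q (-1).
  rewrite diagK // subrr; apply/ffunP=> k; rewrite !ffunE !addr0.
  by case: eqP => [->|_] //; case: eqP => [->|].
clearbody q.
have fp : f p = f q - (partial f a q + partial f b q) + partial (partial f a) b q.
  by rewrite [in LHS]q_back multiaffine_diag //; ring.
have fjp : partial f j p = partial f j q -
    (partial (partial f j) a q + partial (partial f j) b q) +
    partial (partial (partial f j) a) b q.
  by rewrite [in LHS]q_back multiaffine_diag //; ring.
have main : (partial f j q - eta * partial (partial (partial f j) a) b q) * f p <=
    partial f j p * lieb_sokal eta a b f q.
  rewrite fjp fp /lieb_sokal; apply: barrier_ineq => //.
  - exact: pf.
  - exact: partial2_ge0 pq.
  - exact: pos.
  - have := fa' q pq; have := fb' q pq; have := pf q pq; nra.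
  - move=> h /andP[h1 _]; rewrite -multiaffine_diag //; exact/pf/back.
  (* The Wronskian is the sum of the Rayleigh inequalities for [(a, j)] and [(b, j)], which hold on
     the whole diagonal line. *)
  - move=> h; have ja' : a != j by rewrite eq_sym.
    have jb' : b != j by rewrite eq_sym.
    have := rayleigh (diag a b q h) sf ja'; have := rayleigh (diag a b q h) sf jb'.
    rewrite [partial (partial f a) j _]partialC [partial (partial f b) j _]partialC.
    rewrite !(partial_diag_l, partial_diag_r) // !multiaffine_diag //; nra.
have fp0 := pf p (above_refl p).
rewrite partial_lieb_sokal -(ler_pM2r fp0).
have -> : partial (partial (partial f a) b) j q = partial (partial (partial f j) a) b q.
  rewrite partialC; congr (partial _ b q).
  by apply: functional_extensionality => y; rewrite partialC.
apply: le_trans main _; have := pos q pq; nra.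
Qed.

End Barrier.

(** * Deletion and contraction *)

Section Interlacing.
Variables (R : realFieldType) (V : finType).
Implicit Types (f Y : {ffun V -> R} -> R) (r p : {ffun V -> R}) (a b j : V).

Lemma partialCf f i j : partial (partial f i) j = partial (partial f j) i.
Proof. by apply: functional_extensionality => z; exact: partialC. Qed.

Definition deletion b f r := f (upd r b 0).

Definition contraction a b s f r := partial f b (upd r a (r a - s)).

(* Write [Y = P + r_b Q]. Both [P / Q] and [(x Q - eta d_a Q) / Q] are
   nondecreasing in every coordinate, so whichever is positive at the corner [p]
   is positive on the whole orthant. *)
Lemma deletion_or_contraction Y p a b eta : stable Y -> a != b ->
  0 < eta -> 0 < p b -> pos_above p (lieb_sokal eta a b Y) ->
  pos_above p (deletion b Y) \/ pos_above p (contraction a b (eta / p b) Y).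
Proof.
move=> sY ab eta0 x0 pL; have [mY _] := sY.
have sQ := stable_partial b sY; have [mQ _] := sQ.
have mL := multiaffine_lieb_sokal eta a b mY.
set x := p b in x0 *.
have Qb : forall r, partial (lieb_sokal eta a b Y) b r = partial Y b r.
  by move=> r; rewrite partial_lieb_sokal partial_partial mulr0 subr0.
have Q0 r : above p r -> 0 <= partial Y b r.
  by move=> pr; rewrite -Qb; apply: (partial_ge0 b mL _ pr) => q /pL/ltW.
have Qi0 i r : above p r -> 0 <= partial (partial Y b) i r.
  exact: partial_ge0.
have Lval r : lieb_sokal eta a b Y r =
    deletion b Y r + r b * partial Y b r - eta * partial (partial Y b) a r.
  by rewrite /lieb_sokal partialC /deletion -{1}(upd_id r b) (mY r b (r b)).
have ray i r : i != b -> deletion b Y r * partial (partial Y b) i r <=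
    partial Y b r * partial Y i (upd r b 0).
  move=> ib; have := rayleigh (upd r b 0) sY; move=> /(_ b i).
  by rewrite eq_sym ib partialC !(partial_upd (partial Y i)) (partial_upd Y b)
             -[partial (partial Y i) b r]partialC; apply.
have delstep i r t : i != b -> deletion b Y (upd r i (r i + t)) =
    deletion b Y r + t * partial Y i (upd r b 0).
  move=> ib; rewrite /deletion (updC _ _ _ ib) -[r i](upd_neq r 0 (_ : b != i)) 1?eq_sym //.
  exact: multiaffine_add.
have delstepb r t : deletion b Y (upd r b t) = deletion b Y r.
  by rewrite /deletion upd_upd.
have px r : above p r -> 0 < r b by move=> pr; apply: lt_le_trans (pr b).
(* Degenerate case for the quotients: [Q] then vanishes on the whole orthant, where
   [P - eta d_a Q > 0] and [d_a Q >= 0] make deletion work. *)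
have [Qp|Qp] := eqVneq (partial Y b p) 0.
  left; have Qz : forall r, above p r -> partial Y b r = 0.
    apply: above_ind => // r i t pr t0 Qr.
    have [->|ib] := eqVneq i b; first by rewrite partial_upd.
    rewrite multiaffine_add // Qr add0r.
    have := ray i r ib; rewrite Qr mul0r => h.
    have L0 := pL r pr; rewrite Lval Qr mulr0 addr0 in L0.
    have ea := mulr_ge0 (ltW eta0) (Qi0 a r pr).
    have P0 : 0 < deletion b Y r by lra.
    have := Qi0 i r pr; rewrite pmulr_rle0 // in h => h2.
    by rewrite (_ : partial _ i r = 0) ?mulr0 //; apply/eqP; rewrite eq_le h h2.
  move=> r pr; have L0 := pL r pr; rewrite Lval Qz // mulr0 addr0 in L0.
  have ea := mulr_ge0 (ltW eta0) (Qi0 a r pr); lra.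
have Qpos r : above p r -> 0 < partial Y b r.
  move: r; apply: above_ind; first by rewrite lt_def Qp Q0 //; exact: above_refl.
  move=> r i t pr t0 IH; rewrite multiaffine_add //.
  by rewrite ltr_wpDr // mulr_ge0 // Qi0.
have [P0|P0] := ltP 0 (deletion b Y p).
  left; apply: above_ind => // r i t pr t0 IH.
  have [->|ib] := eqVneq i b; first by rewrite delstepb.
  rewrite delstep // ltr_wpDr // mulr_ge0 // -(pmulr_rge0 _ (Qpos r pr)).
  by apply: le_trans (ray i r ib); rewrite mulr_ge0 ?Qi0 // ltW.
right; have cv r : contraction a b (eta / x) Y r =
    partial Y b r - eta / x * partial (partial Y b) a r.
  by rewrite /contraction multiaffine_add // mulNr.
have e0 : 0 < eta / x by rewrite divr_gt0.
apply: above_ind.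
  (* At the corner [P <= 0] while [P + x Q - eta d_a Q > 0]. *)
  have := pL p (above_refl p); rewrite Lval -/x cv => h.
  rewrite -(pmulr_rgt0 _ x0).
  have -> : x * (partial Y b p - eta / x * partial (partial Y b) a p) =
    x * partial Y b p - eta * partial (partial Y b) a p.
    by field; rewrite gt_eqF.
  lra.
move=> r i t pr t0; rewrite !cv; move: (eta / x) e0 => s s0 IH.
have [->|ib] := eqVneq i b.
  by rewrite !partial_upd partialC partial_upd partialC.
have [->|ia] := eqVneq i a.
  rewrite (partial_upd (partial Y b)) multiaffine_add //.
  have := mulr_ge0 t0 (Qi0 a r pr); lra.
rewrite !multiaffine_add //; last exact: multiaffine_partial.
have := rayleigh r sQ ia; have := Qi0 i r pr; have q0 := Qpos r pr.
rewrite [partial (partial (partial Y b) i) a r]partialC => h1 h2.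
have h3 := mulr_ge0 h1 (ltW IH); have := ler_wpM2l (ltW s0) h2 => h4.
have : 0 <= partial (partial Y b) i r - s * partial (partial (partial Y b) a) i r.
  rewrite -(pmulr_rge0 _ q0); lra.
by move=> /(mulr_ge0 t0); lra.
Qed.

End Interlacing.

(** * Processing the edges *)

Section PairProduct.
Variables (K : comNzRingType) (I : finType).
Implicit Types (A B : {ffun I -> K} -> K) (r : {ffun I + I -> K}) (e : I).

Definition left_part r : {ffun I -> K} := [ffun e => r (inl e)].
Definition right_part r : {ffun I -> K} := [ffun e => r (inr e)].

(* The coordinate [inl e] is [z_e], and [inr e] is [w_e]. *)
Definition pair_prod A B r := A (right_part r) * B (left_part r).

Lemma left_part_inl r e a : left_part (upd r (inl e) a) = upd (left_part r) e a.
Proof. by apply/ffunP=> k; rewrite !ffunE. Qed.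
Lemma left_part_inr r e a : left_part (upd r (inr e) a) = left_part r.
Proof. by apply/ffunP=> k; rewrite !ffunE. Qed.
Lemma right_part_inl r e a : right_part (upd r (inl e) a) = right_part r.
Proof. by apply/ffunP=> k; rewrite !ffunE. Qed.
Lemma right_part_inr r e a : right_part (upd r (inr e) a) = upd (right_part r) e a.
Proof. by apply/ffunP=> k; rewrite !ffunE. Qed.

Definition partE :=
  (left_part_inl, left_part_inr, right_part_inl, right_part_inr).

Lemma partial_pair_prod_inl A B e r :
  partial (pair_prod A B) (inl e) r = A (right_part r) * partial B e (left_part r).
Proof. by rewrite /partial /pair_prod !partE mulrBr. Qed.

Lemma partial_pair_prod_inr A B e r :
  partial (pair_prod A B) (inr e) r = partial A e (right_part r) * B (left_part r).
Proof. by rewrite /partial /pair_prod !partE mulrBl. Qed.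

Lemma multiaffine_pair_prod A B :
  multiaffine A -> multiaffine B -> multiaffine (pair_prod A B).
Proof.
move=> mA mB r [e|e] a.
  by rewrite partial_pair_prod_inl /pair_prod !partE (mB _ e a); ring.
by rewrite partial_pair_prod_inr /pair_prod !partE (mA _ e a); ring.
Qed.

End PairProduct.

(** * Operators and selections over a list of edges *)

Section Process.
Local Open Scope complex_scope.
Variables (R : realFieldType) (I : finType).
Implicit Types (A B D : {ffun I -> R} -> R) (f Y : {ffun I + I -> R} -> R).
Implicit Types (r p : {ffun I + I -> R}) (e : I) (s : seq I) (S : {set I}).

Lemma stable_pair_prod A B : stable A -> stable B -> stable (pair_prod A B).
Proof.
move=> [mA [FA [mFA sA hA]]] [mB [FB [mFB sB hB]]].
split; first exact: multiaffine_pair_prod.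
exists (pair_prod FA FB); split; first exact: multiaffine_pair_prod.
  move=> z [e|e] uz.
    rewrite partial_pair_prod_inl /pair_prod.
    have ul : upper_closed (left_part z) by move=> k; rewrite ffunE.
    have := sB _ e ul; move: (FA _) (FB _) (partial _ _ _) => [a b] [c d] [g h].
    rewrite /imdot /= => H.
    have : (a ^+ 2 + b ^+ 2) * (h * c - g * d) <= 0.
      by rewrite mulr_ge0_le0 // addr_ge0 ?sqr_ge0.
    by apply: le_trans; rewrite le_eqVlt; apply/orP; left; apply/eqP; ring.
  rewrite partial_pair_prod_inr /pair_prod.
  have ul : upper_closed (right_part z) by move=> k; rewrite ffunE.
  have := sA _ e ul; move: (FA _) (FB _) (partial _ _ _) => [a b] [c d] [g h].
  rewrite /imdot /= => H.
  have : (c ^+ 2 + d ^+ 2) * (h * a - g * b) <= 0.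
    by rewrite mulr_ge0_le0 // addr_ge0 ?sqr_ge0.
  by apply: le_trans; rewrite le_eqVlt; apply/orP; left; apply/eqP; ring.
move=> r; rewrite /pair_prod.
have -> : right_part (embed r) = embed (right_part r) by apply/ffunP=> k; rewrite !ffunE.
have -> : left_part (embed r) = embed (left_part r) by apply/ffunP=> k; rewrite !ffunE.
rewrite hA hB; apply/eqP; rewrite eq_complex !ReImE /=.
by rewrite !mul0r mulr0 subr0 addr0 !eqxx.
Qed.

Definition lieb_all eta s f :=
  foldr (fun e => lieb_sokal eta (inl e) (inr e)) f s.

Lemma stable_lieb_all eta s f : 0 < eta -> stable f -> stable (lieb_all eta s f).
Proof. by move=> eta0 sf; elim: s => //= e s; apply: stable_lieb_sokal. Qed.

Definition edge_of (v : I + I) := match v with inl e => e | inr e => e end.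

Definition raised s : {ffun I + I -> R} :=
  [ffun v => if edge_of v \in s then 2 else 1].

(** Each step raises only the two coordinates of its own edge, and the bound [beta] survives at the
    untreated edges, which is all that the next step uses. *)
Lemma barrier_all eta beta s f : stable f -> uniq s ->
  0 < eta -> 0 < beta -> eta * beta ^+ 2 < 1 -> 2 * eta * beta <= 1 ->
  pos_above [ffun=> 1] f ->
  (forall v, partial f v [ffun=> 1] <= beta * f [ffun=> 1]) ->
  pos_above (raised s) (lieb_all eta s f) /\
  forall v, edge_of v \notin s ->
    partial (lieb_all eta s f) v (raised s) <= beta * lieb_all eta s f (raised s).
Proof.
move=> sf us eta0 beta0 eb1 eb2 pf hf.
elim: s us => [_|e s IH /= /andP[es us]].
  by rewrite (_ : raised [::] = [ffun=> 1]) //; apply/ffunP=> v; rewrite !ffunE.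
have [p1 h1] := IH us.
have -> : raised (e :: s) = diag (inl e) (inr e) (raised s) 1.
  apply/ffunP=> v; rewrite !ffunE in_cons /=.
  have xor : (edge_of v == e) = (v == inl e) || (v == inr e).
    by case: v => k /=; rewrite ?orbF.
  rewrite xor (negPf es).
  by case: (v == inr e); case: (v == inl e).
have [] := barrier_step (stable_lieb_all s eta0 sf) _ p1 eta0 beta0 eb1 eb2
  (h1 (inl e) es) (h1 (inr e) es) => // p2 h2; split=> // v.
rewrite in_cons negb_or => /andP[ve vs].
by apply: h2; rewrite ?h1 //; apply: contraNneq ve => ->.
Qed.

Lemma partial_deletion c a f : a != c ->
  partial (deletion c f) a = deletion c (partial f a).
Proof.
move=> ac; apply: functional_extensionality => r.
by rewrite /deletion partial_updN.
Qed.

Lemma partial_contraction c d t a f : a != c ->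
  partial (contraction c d t f) a = contraction c d t (partial f a).
Proof.
move=> ac; apply: functional_extensionality => r.
rewrite /contraction partialCf {1}/partial !upd_neq // !(updC _ _ _ ac).
by rewrite [in RHS]/partial.
Qed.

Lemma lieb_sokal_deletion eta c a b f : a != c -> b != c ->
  lieb_sokal eta a b (deletion c f) = deletion c (lieb_sokal eta a b f).
Proof.
move=> ac bc; apply: functional_extensionality => r.
by rewrite /lieb_sokal !partial_deletion.
Qed.

Lemma lieb_sokal_contraction eta c d t a b f : a != c -> b != c ->
  lieb_sokal eta a b (contraction c d t f) = contraction c d t (lieb_sokal eta a b f).
Proof.
move=> ac bc; apply: functional_extensionality => r.
by rewrite /lieb_sokal !partial_contraction // /contraction partial_lieb_sokal.
Qed.

(** A choice at [e] commutes with the operators of the other edges, so it can be moved inside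
    them. *)
Lemma lieb_all_deletion eta s e f : e \notin s ->
  lieb_all eta s (deletion (inr e) f) = deletion (inr e) (lieb_all eta s f).
Proof.
elim: s => //= k s IH; rewrite in_cons negb_or => /andP[ek es].
by rewrite IH // lieb_sokal_deletion // inj_eq 1?eq_sym //; exact: inr_inj.
Qed.

Lemma lieb_all_contraction eta s e t f : e \notin s ->
  lieb_all eta s (contraction (inl e) (inr e) t f) =
  contraction (inl e) (inr e) t (lieb_all eta s f).
Proof.
elim: s => //= k s IH; rewrite in_cons negb_or => /andP[ek es].
by rewrite IH // lieb_sokal_contraction // inj_eq 1?eq_sym //; exact: inl_inj.
Qed.

Fixpoint select (t : R) S s f := if s is e :: s' then
    select t S s' (if e \in S then contraction (inl e) (inr e) t f
                   else deletion (inr e) f)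
  else f.

Lemma eq_select t S S' s f : {in s, S =i S'} -> select t S s f = select t S' s f.
Proof.
elim: s f => //= e s IH f h; rewrite h ?mem_head //; apply: IH => k ks.
by rewrite h // in_cons ks orbT.
Qed.

(** The operator of the first edge is outermost; [deletion_or_contraction] removes it, and the
    choice moves inside the others for the induction. The shift is [eta / 2] because the corner
    coordinates are [2]. *)
Lemma exists_selection eta s Y : 0 < eta -> stable Y -> uniq s ->
  pos_above [ffun=> 2] (lieb_all eta s Y) ->
  exists S, pos_above [ffun=> 2] (select (eta / 2) S s Y).
Proof.
move=> eta0; elim: s Y => [Y _ _ h|e s IH Y sY /= /andP[es us] h].
  by exists set0.
have [] := deletion_or_contraction (stable_lieb_all s eta0 sY) _ eta0 _ h => //.
- by rewrite ffunE.
- rewrite -lieb_all_deletion // => /IH[]//; first exact: stable_restrict.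
  move=> S hS; exists (S :\ e); rewrite !inE eqxx /=.
  rewrite (_ : select _ _ _ _ = select (eta / 2) S s (deletion (inr e) Y)) //.
  apply: eq_select => k ks; rewrite !inE; case: eqP => // ke.
  by rewrite -ke ks in es.
rewrite ffunE -lieb_all_contraction // => /IH[]//.
  by apply: (stable_shift (inl e)); apply: stable_partial.
move=> S hS; exists (e |: S); rewrite !inE eqxx /=.
rewrite (_ : select _ _ _ _ =
             select (eta / 2) S s (contraction (inl e) (inr e) (eta / 2) Y)) //.
apply: eq_select => k ks; rewrite !inE; case: eqP => // ke.
by rewrite -ke ks in es.
Qed.

(* The coefficient of the monomial with support [S], once [s] lists all edges. *)
Fixpoint coef S s A := if s is e :: s' then
    coef S s' (if e \in S then partial A e else fun z => A (upd z e 0))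
  else A.

Definition lower (t : R) S (z : {ffun I -> R}) : {ffun I -> R} :=
  [ffun e => if e \in S then z e - t else z e].

(** Deletion and the derivative act on the [w] factor only, the shift on the [z] factor only. *)
Lemma select_pair_prod t S s A B r : uniq s ->
  select t S s (pair_prod A B) r =
  coef S s A (right_part r) * B (lower t (S :&: [set e in s]) (left_part r)).
Proof.
elim: s A B r => [|e s IH] A B r /=.
  move=> _; rewrite /pair_prod; congr (_ * B _).
  by apply/ffunP=> k; rewrite !ffunE !inE andbF.
move=> /andP[es us]; case: ifP => eS.
  have -> : contraction (inl e) (inr e) t (pair_prod A B) =
      pair_prod (partial A e) (fun z => B (upd z e (z e - t))).
    apply: functional_extensionality => y.
    by rewrite /contraction partial_pair_prod_inr /pair_prod !partE ffunE.
  rewrite IH //; congr (_ * B _); apply/ffunP=> k; rewrite !ffunE !inE.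
  case: eqP => [->|//]; by rewrite eS (negPf es).
have -> : deletion (inr e) (pair_prod A B) = pair_prod (fun z => A (upd z e 0)) B.
  by apply: functional_extensionality => y; rewrite /deletion /pair_prod !partE.
rewrite IH //; congr (_ * B _); apply/ffunP=> k; rewrite !ffunE !inE.
by case: eqP => [->|//]; rewrite eS.
Qed.

(** Every coordinate in [s] is overwritten before [A] is evaluated. *)
Lemma coef_eq S s A z z' :
  (forall y y' : {ffun I -> R}, {in s, y =1 y'} -> A y = A y') ->
  coef S s A z = coef S s A z'.
Proof.
elim: s A => [|e s IH] A h /=; first exact: h.
have h' (b : R) (y y' : {ffun I -> R}) : {in s, y =1 y'} ->
    A (upd y e b) = A (upd y' e b).
  move=> H; apply: h => k; rewrite in_cons !ffunE.
  by case: eqP => //= _ /H.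
by case: ifP => _; apply: IH => y y' H; rewrite /partial !(h' _ _ _ H).
Qed.

(** [A] is only evaluated at points that vanish on the part of [s] outside [S]. *)
Lemma coef_vanish S s A z :
  (forall y : {ffun I -> R},
     (forall e, e \notin S -> e \in s -> y e = 0) -> A y = 0) ->
  coef S s A z = 0.
Proof.
elim: s A => [|e s IH] A h /=; first exact: h.
case: ifP => eS; apply: IH => y hy.
  rewrite /partial !h ?subrr // => k kS; rewrite in_cons => /orP[/eqP ke|ks].
  - by rewrite -ke (negPf kS) in eS.
  - by rewrite upd_neq ?hy //; apply: contraNneq kS => <-.
  - by rewrite -ke (negPf kS) in eS.
  - by rewrite upd_neq ?hy //; apply: contraNneq kS => <-.
apply: h => k kS; rewrite in_cons ffunE; case: eqP => //= _; exact: hy.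
Qed.

Definition dbl (z : {ffun I -> R}) : {ffun I -> R} := [ffun e => 2 * z e].

(** Degree [d] is encoded as [c = 2^d], and each derivative turns [c] into [c / 2]; a nonzero
    coefficient thus reveals the size of its support. *)
Lemma coef_homogeneous c S s A z : multiaffine A ->
  (forall y, A (dbl y) = c * A y) ->
  2 ^+ count (mem S) s * coef S s A (dbl z) = c * coef S s A z.
Proof.
elim: s A c => [|e s IH] A c mA h /=; first by rewrite mul1r.
have dblE y (b : R) : dbl (upd y e b) = upd (dbl y) e (2 * b).
  by apply/ffunP=> k; rewrite !ffunE; case: eqP.
case: ifP => eS.
  have h' y : partial A e (dbl y) = c / 2 * partial A e y.
    rewrite {2}/partial mulrBr.
    apply: (@mulfI _ 2); first by rewrite pnatr_eq0.
    have -> : 2 * (c / 2 * A (upd y e 1) - c / 2 * A (upd y e 0)) =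
      c * A (upd y e 1) - c * A (upd y e 0) by field.
    by rewrite -!h !dblE !(mA _ e (2 * _)); ring.
  move: (IH _ _ (multiaffine_partial e mA) h').
  by move=> H; rewrite add1n exprS -[LHS]mulrA H; field.
rewrite [(false + _)%N]add0n; apply: IH; first exact: multiaffine_restrict.
by move=> y; rewrite -h dblE mulr0.
Qed.

End Process.

(** * Determinants of Gram matrices *)

Section RankOne.
Variables (K : comUnitRingType) (n : nat).
Implicit Types (M : 'M[K]_n) (u : 'cV[K]_n) (v : 'rV[K]_n).

(** This Schur complement puts [v] into a single row, so multilinearity of the determinant applies
    even when [M] is singular. *)
Lemma det_block_rank1 M u v :
  \det (block_mx M (- u) v (1%:M : 'M_1)) = \det (M + u *m v).
Proof.
have := mulmx_block M (- u) v (1%:M : 'M_1) (1%:M : 'M_n) 0 (- v) 1%:M.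
rewrite !mulmx1 !mulmx0 !mul1mx mulmxN mulNmx opprK subrr !add0r.
move/(congr1 determinant); rewrite det_mulmx det_lblock det_ublock !det1.
by rewrite !mulr1.
Qed.

Lemma det_rank1_affine M u v t :
  \det (M + t *: (u *m v)) = \det M + t * (\det (M + u *m v) - \det M).
Proof.
rewrite scalemxAr -!det_block_rank1.
have -> : \det M = \det (block_mx M (- u) 0 (1%:M : 'M_1)).
  by rewrite det_ublock det1 mulr1.
have E m (A B : 'M[K]_(1, m)) : row' ord0 A = row' ord0 B.
  by apply/matrixP=> i j; have := ltn_ord i.
(* The last row [(t v, 1)] is [t (v, 1) + (1 - t) (0, 1)]. *)
rewrite (@determinant_multilinear _ _ _ (block_mx M (- u) v 1%:M)
  (block_mx M (- u) 0 1%:M) (rshift n ord0) t (1 - t)); first by ring.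
- rewrite /block_mx !rowKd; apply/rowP => j; rewrite !mxE.
  by case: split => k; rewrite !mxE; ring.
- by rewrite /block_mx !row'Kd (E (n + 1)%N (row_mx v 1%:M) (row_mx (t *: v) 1%:M)).
- by rewrite /block_mx !row'Kd (E (n + 1)%N (row_mx 0 1%:M) (row_mx (t *: v) 1%:M)).
Qed.

Lemma det_rank1_update M u v : M \in unitmx ->
  \det (M + u *m v) = \det M * (1 + (v *m invmx M *m u) 0 0).
Proof.
move=> uM; rewrite -det_block_rank1.
have -> : block_mx M (- u) v (1%:M : 'M_1) =
    block_mx 1%:M 0 (v *m invmx M) 1%:M *m
    block_mx M (- u) 0 (1%:M + v *m invmx M *m u).
  rewrite mulmx_block !mulmx0 !mul0mx !mul1mx mulmxKV // !addr0 mulmxN.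
  by rewrite addrCA addNr addr0.
rewrite det_mulmx det_lblock det_ublock !det1 !mul1r det_mx11.
by rewrite !mxE eqxx.
Qed.

End RankOne.

Section Gram.
Variables (K : comUnitRingType) (n : nat) (I : finType).
Implicit Types (a : I -> 'cV[K]_n) (J : 'M[K]_n) (z : {ffun I -> K}) (e : I).

Definition gram a J z : 'M[K]_n := \sum_e z e *: (a e *m (a e)^T) + J.

Definition gram_det a J z := \det (gram a J z).

Lemma gram_upd a J z e t :
  gram a J (upd z e t) = gram a J (upd z e 0) + t *: (a e *m (a e)^T).
Proof.
have E b : gram a J (upd z e b) =
    b *: (a e *m (a e)^T) + (\sum_(k | k != e) z k *: (a k *m (a k)^T) + J).
  rewrite /gram (bigD1 e) //= upd_eq addrA; congr (_ + _ + _).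
  by apply: eq_bigr => k ke; rewrite upd_neq // eq_sym.
by rewrite !E scale0r add0r addrC.
Qed.

Lemma multiaffine_gram_det a J : multiaffine (gram_det a J).
Proof.
move=> z e t; rewrite /partial /gram_det !(gram_upd _ _ _ _ t).
by rewrite det_rank1_affine (gram_upd _ _ _ _ 1) scale1r.
Qed.

Lemma gram_entry a J z k j :
  gram a J z k j = \sum_e z e * (a e k 0 * a e j 0) + J k j.
Proof.
rewrite mxE summxE; congr (_ + _); apply: eq_bigr => e _.
by rewrite mxE mxE big_ord1 mxE.
Qed.

End Gram.

(** * Bilinear forms and positive definite matrices *)

Section QuadraticForms.
Variables (R : realFieldType).

Definition dot n (x y : 'cV[R]_n) : R := (x^T *m y) 0 0.

Definition bilin n (M : 'M[R]_n) (x y : 'cV[R]_n) : R := dot x (M *m y).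

Definition posdef n (M : 'M[R]_n) := forall x, x != 0 -> 0 < bilin M x x.

Lemma dotC n (x y : 'cV[R]_n) : dot x y = dot y x.
Proof. by rewrite /dot !mxE; apply: eq_bigr => i _; rewrite !mxE mulrC. Qed.

Lemma dotDr n (x y z : 'cV[R]_n) : dot x (y + z) = dot x y + dot x z.
Proof. by rewrite /dot mulmxDr mxE. Qed.

Lemma dotZr n (x y : 'cV[R]_n) t : dot x (t *: y) = t * dot x y.
Proof. by rewrite /dot -scalemxAr mxE. Qed.

Lemma dot0r n (x : 'cV[R]_n) : dot x 0 = 0.
Proof. by rewrite /dot mulmx0 mxE. Qed.

Lemma dot_mul n m (P : 'M[R]_(n, m)) x y : dot x (P *m y) = dot (P^T *m x) y.
Proof. by rewrite /dot trmx_mul trmxK mulmxA. Qed.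

Section Fixed.
Variable n : nat.
Implicit Types (M N A B J : 'M[R]_n) (u x y p q : 'cV[R]_n).

Lemma bilinD M N x y : bilin (M + N) x y = bilin M x y + bilin N x y.
Proof. by rewrite /bilin mulmxDl dotDr. Qed.

Lemma bilinZ t M x y : bilin (t *: M) x y = t * bilin M x y.
Proof. by rewrite /bilin -scalemxAl dotZr. Qed.

Lemma bilin_sym M x y : M^T = M -> bilin M x y = bilin M y x.
Proof. by move=> sM; rewrite /bilin dot_mul sM dotC. Qed.

Lemma bilinDr M x y z : bilin M x (y + z) = bilin M x y + bilin M x z.
Proof. by rewrite /bilin mulmxDr dotDr. Qed.

Lemma bilinZr M x y t : bilin M x (t *: y) = t * bilin M x y.
Proof. by rewrite /bilin -scalemxAr dotZr. Qed.

Lemma bilin_rank1 u x y : bilin (u *m u^T) x y = dot u x * dot u y.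
Proof.
rewrite /bilin -mulmxA [u^T *m y]mx11_scalar mul_mx_scalar dotZr.
by rewrite mulrC dotC.
Qed.

Lemma gramE (I : finType) (a : I -> 'cV[R]_n) J z x y :
  bilin (gram a J z) x y = \sum_e z e * (dot (a e) x * dot (a e) y) + bilin J x y.
Proof.
rewrite bilinD; congr (_ + _).
rewrite /bilin mulmx_suml /dot mulmx_sumr summxE; apply: eq_bigr => e _.
by rewrite -[LHS]/(bilin (z e *: (a e *m (a e)^T)) x y) bilinZ bilin_rank1.
Qed.

Lemma gram_sym (I : finType) (a : I -> 'cV[R]_n) J z : J^T = J -> (gram a J z)^T = gram a J z.
Proof.
move=> sJ; rewrite /gram linearD /= sJ linear_sum /=; congr (_ + _).
by apply: eq_bigr => e _; rewrite linearZ /= trmx_mul trmxK.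
Qed.

End Fixed.

Lemma posdef_unit n (M : 'M[R]_n) : posdef M -> M \in unitmx.
Proof.
move=> pM; rewrite -unitmx_tr unitmxE unitfE; apply/det0P => -[v v0 vM].
have : v^T != 0 by rewrite -[0]trmx0 (inj_eq trmx_inj).
move/pM; rewrite /bilin -[M]trmxK -trmx_mul vM trmx0 dot0r ltxx //.
Qed.

(** Induction through the Schur complement [S] of the corner entry [t]: the determinant is
    [t * det S]. *)
Lemma posdef_det n (M : 'M[R]_n) : M^T = M -> posdef M -> 0 < \det M.
Proof.
elim: n M => [|n IH] M sM pM; first by rewrite det_mx00.
move: M sM pM; rewrite -[n.+1]/(1 + n)%N => M.
rewrite -[M]submxK; move: (ulsubmx M) (ursubmx M) (dlsubmx M) (drsubmx M).
move=> A b c D; rewrite tr_block_mx => /eq_block_mx [_ cb bc sD] pM.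
rewrite [A]mx11_scalar in pM *; move: (A 0 0) pM => t pM.
have t0 : 0 < t.
  have : col_mx (1%:M : 'M_1) (0 : 'cV[R]_n) != 0.
    apply/eqP => /(congr1 usubmx); rewrite col_mxKu linear0 => /matrixP/(_ 0 0)/eqP.
    by rewrite !mxE oner_eq0.
  move/pM; rewrite /bilin /dot tr_col_mx mul_block_col mul_row_col.
  by rewrite trmx0 mul0mx addr0 mulmx0 addr0 trmx1 mul1mx mulmx1 mxE.
pose S := D - t^-1 *: (c *m b).
have dec : block_mx t%:M b c D =
    block_mx 1%:M 0 (t^-1 *: c) 1%:M *m block_mx t%:M b 0 S.
  rewrite mulmx_block !mul1mx !mulmx0 !mul0mx !addr0 mul_mx_scalar scalerA.
  by rewrite divff ?gt_eqF // scale1r /S -scalemxAl addrC subrK.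
rewrite dec det_mulmx det_lblock det_ublock !det1 !mul1r det_scalar1.
rewrite mulr_gt0 // IH //.
  by rewrite /S linearB /= sD linearZ /= trmx_mul cb bc.
move=> y y0.
(* At this vector the form of the block matrix equals the form of [S] at [y]. *)
have x0 : col_mx (- (t^-1 *: (b *m y))) y != 0.
  by apply: contra_neq y0 => /(congr1 dsubmx); rewrite col_mxKd linear0.
move: (pM _ x0); rewrite /bilin mul_block_col.
rewrite mul_scalar_mx scalerN scalerA divff ?gt_eqF // scale1r addNr.
rewrite /dot tr_col_mx mul_row_col mulmx0 add0r.
by rewrite /S mulmxBl mulmxN -scalemxAr mulmxA addrC -scalemxAl.
Qed.

End QuadraticForms.

(** * Stability of the Gram determinant *)

Section GramStable.
Local Open Scope complex_scope.
Local Notation Re := complex.Re.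
Local Notation Im := complex.Im.
Variables (R : realFieldType) (n : nat) (I : finType).
Variables (a : I -> 'cV[R]_n) (J : 'M[R]_n).
Hypothesis J_sym : J^T = J.
Local Notation C := R[i].

Lemma Re_sum (T : finType) (F : T -> C) : Re (\sum_i F i) = \sum_i Re (F i).
Proof. by apply: (big_morph (complex.Re (R := R))) => // x y; rewrite cReD. Qed.

Lemma Im_sum (T : finType) (F : T -> C) : Im (\sum_i F i) = \sum_i Im (F i).
Proof. by apply: (big_morph (complex.Im (R := R))) => // x y; rewrite cImD. Qed.

Let aC e := map_mx (real_complex R) (a e).
Let JC := map_mx (real_complex R) J.

Lemma gram_embed z : gram aC JC (embed z) = map_mx (real_complex R) (gram a J z).
Proof.
apply/matrixP=> i j; rewrite [RHS]mxE !gram_entry rmorphD rmorph_sum mxE.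
by congr (_ + _); apply: eq_bigr => e _; rewrite !rmorphM !mxE ffunE.
Qed.

Lemma Re_gram (z : {ffun I -> C}) :
  map_mx (@complex.Re R) (gram aC JC z) = gram a J [ffun e => Re (z e)].
Proof.
apply/matrixP=> i j; rewrite mxE !gram_entry cReD Re_sum mxE.
congr (_ + _); apply: eq_bigr => e _.
by rewrite !mxE ffunE !ReImE /=; ring.
Qed.

Lemma Im_gram (z : {ffun I -> C}) :
  map_mx (@complex.Im R) (gram aC JC z) = gram a 0 [ffun e => Im (z e)].
Proof.
apply/matrixP=> i j; rewrite mxE !gram_entry cImD Im_sum !mxE /=.
congr (_ + _); apply: eq_bigr => e _.
by rewrite !mxE ffunE !ReImE /=; ring.
Qed.

Lemma Re_mulmx m k l (A : 'M[C]_(m, k)) (B : 'M[C]_(k, l)) :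
  map_mx (@complex.Re R) (A *m B) =
  map_mx (@complex.Re R) A *m map_mx (@complex.Re R) B -
  map_mx (@complex.Im R) A *m map_mx (@complex.Im R) B.
Proof.
apply/matrixP=> i j; rewrite !mxE Re_sum -sumrB; apply: eq_bigr => e _.
by rewrite !mxE cReM.
Qed.

Lemma Im_mulmx m k l (A : 'M[C]_(m, k)) (B : 'M[C]_(k, l)) :
  map_mx (@complex.Im R) (A *m B) =
  map_mx (@complex.Re R) A *m map_mx (@complex.Im R) B +
  map_mx (@complex.Im R) A *m map_mx (@complex.Re R) B.
Proof.
apply/matrixP=> i j; rewrite !mxE Im_sum -big_split; apply: eq_bigr => e _.
by rewrite !mxE cImM.
Qed.

(* With the Gram matrix written [A + i B] and its inverse applied to [a_e] written
   [p + i q], the imaginary part is [a_e^T q = - (p^T B p + q^T B q)]. *)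
Lemma Im_resolvent_le0 (z : {ffun I -> C}) e : upper_closed z ->
  gram aC JC z \in unitmx ->
  Im (((aC e)^T *m invmx (gram aC JC z) *m aC e) 0 0) <= 0.
Proof.
move=> uz; set M := gram aC JC z => uM.
pose u := invmx M *m aC e; have Mu : M *m u = aC e by rewrite mulKVmx.
pose A := gram a J [ffun k => Re (z k)]; pose B := gram a 0 [ffun k => Im (z k)].
pose p := map_mx (@complex.Re R) u; pose q := map_mx (@complex.Im R) u.
have reA : map_mx (@complex.Re R) (aC e) = a e by apply/matrixP=> i j; rewrite !mxE.
have imA : map_mx (@complex.Im R) (aC e) = 0 by apply/matrixP=> i j; rewrite !mxE.
have e1 : a e = A *m p - B *m q by rewrite -reA -Mu Re_mulmx Re_gram Im_gram.
have e2 : A *m q = - (B *m p).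
  have := imA; rewrite -{1}Mu Im_mulmx Re_gram Im_gram => /eqP.
  by rewrite addr_eq0 => /eqP.
have -> : Im (((aC e)^T *m invmx M *m aC e) 0 0) = dot (a e) q.
  rewrite -mulmxA -/u; set T := _ *m u.
  have -> : Im (T 0 0) = map_mx (@complex.Im R) T 0 0 by rewrite [RHS]mxE.
  rewrite Im_mulmx -!map_trmx reA imA trmx0 mul0mx addr0.
  by [].
have B0 x : 0 <= bilin B x x.
  rewrite gramE /bilin mul0mx dot0r addr0 sumr_ge0 // => k _.
  by rewrite ffunE mulr_ge0 // -expr2 sqr_ge0.
have sA := gram_sym a [ffun k => Re (z k)] J_sym.
rewrite e1 dotC dotDr -[dot q (A *m p)]/(bilin A q p) bilin_sym //.
rewrite /bilin e2 -!scaleN1r !dotZr.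
have := B0 p; have := B0 q; rewrite /bilin; lra.
Qed.

(** The rank one update gives [d_e D = D s] with [s = a_e^T M^-1 a_e], so the quantity to bound is
    [|D|^2 Im s]. *)
Lemma stable_gram_det : stable (gram_det a J).
Proof.
split; first exact: multiaffine_gram_det.
exists (gram_det aC JC); split; first exact: multiaffine_gram_det.
  move=> z e uz; have mD := multiaffine_gram_det aC JC.
  have [D0|D0] := eqVneq (gram_det aC JC z) 0.
    by rewrite D0 /imdot /= !mulr0 subrr.
  have uM : gram aC JC z \in unitmx by rewrite unitmxE unitfE.
  have step : gram aC JC (upd z e (z e + 1)) = gram aC JC z + aC e *m (aC e)^T.
    rewrite (gram_upd _ _ _ _ (z e + 1)) scalerDl scale1r addrA -gram_upd.
    by rewrite upd_id.
  have := multiaffine_add z e 1 mD; rewrite mul1r => /eqP.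
  rewrite {1}/gram_det step det_rank1_update // mulrDr mulr1 (inj_eq (addrI _)).
  move=> /eqP <-; have := Im_resolvent_le0 e uz uM.
  rewrite -/(gram_det aC JC z).
  move: (gram_det _ _ _) (_ 0 0) => d s hs; rewrite /imdot !ReImE.
  have -> : (Re d * Im s + Im d * Re s) * Re d - (Re d * Re s - Im d * Im s) * Im d =
    (Re d ^+ 2 + Im d ^+ 2) * Im s by ring.
  by rewrite mulr_ge0_le0 // addr_ge0 ?sqr_ge0.
by move=> r; rewrite /gram_det gram_embed det_map_mx.
Qed.

End GramStable.

Lemma det_rank1_dot (R : realFieldType) n (N : 'M[R]_n) (u : 'cV[R]_n) c :
  N \in unitmx ->
  \det (N + c *: (u *m u^T)) = \det N * (1 + c * dot u (invmx N *m u)).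
Proof.
move=> uN; rewrite scalemxAl det_rank1_update //.
by rewrite -scalemxAr [in LHS]mxE -mulmxA.
Qed.

Lemma bilin_expand (R : realFieldType) n (N : 'M[R]_n) (x w : 'cV[R]_n) k :
  N^T = N ->
  bilin N (x + k *: w) (x + k *: w) =
  bilin N x x + 2 * k * bilin N x w + k ^+ 2 * bilin N w w.
Proof.
move=> sN; rewrite bilinDr bilinZr (bilin_sym _ x) // (bilin_sym _ w) //.
by rewrite !bilinDr !bilinZr (bilin_sym w x) //; ring.
Qed.

(** The determinant condition says [t s < 1] for [s = u^T N^-1 u]. With [b = u^T x], nonnegativity
    of the form of [N] at [x - t b N^-1 u] gives [x^T N x >= t b^2 + t b^2 (1 - t s)]. *)
Lemma posdef_downdate (R : realFieldType) n (N : 'M[R]_n) (u : 'cV[R]_n) t :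
  N^T = N -> posdef N -> 0 <= t -> 0 < \det (N - t *: (u *m u^T)) ->
  posdef (N - t *: (u *m u^T)).
Proof.
move=> sN pN t0; have uN := posdef_unit pN.
rewrite -scaleNr det_rank1_dot // (pmulr_rgt0 _ (posdef_det sN pN)).
set w := invmx N *m u; have Nw : N *m w = u by rewrite mulKVmx.
have [s hs] : exists s, s = dot u w by exists (dot u w).
rewrite -hs => s1 x x0.
rewrite bilinD bilinZ bilin_rank1.
have Nx := pN x x0; set b := dot u x.
have ww : bilin N w w = s by rewrite /bilin Nw dotC -hs.
have xw : bilin N x w = b by rewrite /bilin Nw dotC.
have h : 0 <= bilin N (x + (- (t * b)) *: w) (x + (- (t * b)) *: w).
  have [->|y0] := eqVneq (x + (- (t * b)) *: w) 0; last exact/ltW/pN.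
  by rewrite /bilin mulmx0 dot0r.
rewrite bilin_expand // xw ww in h.
move: Nx h s1; move: (bilin N x x) => m m0 h s1.
have [b0|b0] := eqVneq (t * b ^+ 2) 0.
  by rewrite mulNr -expr2 b0 subr0.
have tb : 0 < t * b ^+ 2 by rewrite lt_def b0 mulr_ge0 // sqr_ge0.
have := mulr_gt0 tb s1; nra.
Qed.

(** * Existence of a spectrally thin set of edges *)

Section Selection.
Variables (R : realFieldType) (n : nat) (I : finType).
Variables (a : I -> 'cV[R]_n) (J : 'M[R]_n).
Hypothesis J_sym : J^T = J.
Hypothesis N_posdef : posdef (gram a J [ffun=> 1]).
Local Notation D := (gram_det a J).

Lemma posdef_gram (z : {ffun I -> R}) : (forall e, 1 <= z e) -> posdef (gram a J z).
Proof.
move=> z1 x x0; apply: lt_le_trans (N_posdef x0) _.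
rewrite !gramE lerD2r ler_sum // => e _.
by rewrite ffunE ler_wpM2r // -expr2 sqr_ge0.
Qed.

Lemma gram_det_gt0 (z : {ffun I -> R}) : (forall e, 1 <= z e) -> 0 < D z.
Proof. by move=> /posdef_gram; apply: posdef_det; apply: gram_sym. Qed.

(* Coordinates are lowered one at a time from [2] to [p]: a rank one downdate of a
   positive definite matrix stays positive definite if its determinant stays
   positive. *)
Lemma posdef_gram_above (p : {ffun I -> R}) : (forall e, p e <= 2) -> pos_above p D ->
  posdef (gram a J p).
Proof.
move=> p2 pos.
pose q (s : seq I) : {ffun I -> R} := [ffun e => if e \in s then p e else 2].
have Pq : forall s, posdef (gram a J (q s)).
  elim=> [|e s IH].
    by apply: posdef_gram => e; rewrite ffunE /= ler1n.
  have [es|es] := boolP (e \in s).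
    rewrite (_ : q (e :: s) = q s) //; apply/ffunP=> k.
    by rewrite !ffunE inE; case: eqP => // ->; rewrite es.
  have E : gram a J (q (e :: s)) =
      gram a J (q s) - (2 - p e) *: (a e *m (a e)^T).
    have -> : q (e :: s) = upd (q s) e (p e).
      by apply/ffunP=> k; rewrite !ffunE inE; case: eqP => [->|].
    have := gram_upd a J (q s) e (q s e); rewrite upd_id => ->.
    rewrite (gram_upd _ _ _ _ (p e)) (_ : q s e = 2) ?ffunE ?(negPf es) //.
    rewrite scalerBl opprB -[RHS]addrA; congr (_ + _).
    by rewrite addrC subrK.
  rewrite E; apply: posdef_downdate => //; first exact: gram_sym.
    by rewrite subr_ge0.
  rewrite -E; apply: pos => k; rewrite ffunE; case: ifP => // _.
rewrite (_ : p = q (enum I)) //.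
by apply/ffunP=> k; rewrite ffunE mem_enum.
Qed.

Lemma thin_selection beta : 0 < beta -> beta <= 1 ->
  (forall e, dot (a e) (invmx (gram a J [ffun=> 1]) *m a e) <= beta) ->
  exists S : {set I}, coef S (enum I) D [ffun=> 0] != 0 /\
    posdef (gram a J (lower (4 * beta)^-1 S [ffun=> 2])).
Proof.
move=> b0 b1 hb; set N := gram a J _ in hb.
(* The largest [eta] with [2 eta beta <= 1]; then [eta beta^2 = beta / 2 < 1] because
   [beta <= 1]. *)
pose eta := (2 * beta)^-1.
have bn : beta != 0 by rewrite gt_eqF.
have eta0 : 0 < eta by rewrite invr_gt0 mulr_gt0.
have sD : stable D := stable_gram_det a J_sym; have [mD _] := sD.
have pD : 0 < D [ffun=> 1] by apply: gram_det_gt0 => e; rewrite ffunE.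
have dD e : partial D e [ffun=> 1] <= beta * D [ffun=> 1].
  have := multiaffine_add [ffun=> 1] e 1 mD; rewrite mul1r => /eqP.
  rewrite {1}/gram_det (gram_upd _ _ _ _ (_ + 1)) scalerDl addrA -gram_upd.
  rewrite upd_id det_rank1_dot; last exact: posdef_unit.
  rewrite mul1r mulrDr mulr1 (inj_eq (addrI _)) => /eqP <-.
  by rewrite mulrC ler_pM2r // hb.
have rp : right_part [ffun=> 1] = [ffun=> 1] :> {ffun I -> R}.
  by apply/ffunP=> e; rewrite !ffunE.
have lp : left_part [ffun=> 1] = [ffun=> 1] :> {ffun I -> R}.
  by apply/ffunP=> e; rewrite !ffunE.
have [] := @barrier_all _ _ eta beta (enum I) (pair_prod D D)
  (stable_pair_prod sD sD) (enum_uniq I) eta0 b0.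
- by rewrite (_ : eta * beta ^+ 2 = beta / 2); [lra | rewrite /eta; field].
- by rewrite (_ : 2 * eta * beta = 1) // /eta; field.
- move=> r r1; rewrite /pair_prod mulr_gt0 // gram_det_gt0 // => e;
  by rewrite ffunE; have := r1 (inl e); have := r1 (inr e); rewrite !ffunE.
- case=> e; rewrite ?partial_pair_prod_inl ?partial_pair_prod_inr /pair_prod.
    by rewrite rp lp mulrCA ler_pM2l.
  by rewrite rp lp mulrA ler_pM2r.
have -> : raised R (enum I) = [ffun=> 2].
  by apply/ffunP=> v; rewrite !ffunE mem_enum.
move=> posL _.
have [S hS] := exists_selection eta0 (stable_pair_prod sD sD) (enum_uniq I) posL.
exists S; rewrite (_ : (4 * beta)^-1 = eta / 2); last by rewrite /eta; field.
set t := eta / 2; have t0 : 0 < t by rewrite divr_gt0.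
set c := coef _ _ _ _.
have Sfull : S :&: [set e in enum I] = S.
  by apply/setP=> e; rewrite !inE mem_enum andbT.
(* With the [w] coordinates frozen at [2], the selected function is the constant [c] times a shifted
   [D]. *)
have main (z : {ffun I -> R}) : (forall e, 2 <= z e) -> 0 < c * D (lower t S z).
  move=> z2; pose r : {ffun I + I -> R} :=
    [ffun v => match v with inl e => z e | inr _ => 2 end].
  have := hS r; rewrite select_pair_prod ?enum_uniq // Sfull.
  rewrite (_ : left_part r = z); last by apply/ffunP=> e; rewrite !ffunE.
  rewrite (@coef_eq _ _ S _ _ _ [ffun=> 0]); first by apply; case=> e; rewrite !ffunE.
  by move=> y y' h; congr D; apply/ffunP=> e; apply: h; rewrite mem_enum.
have c0 : 0 < c.
  (* At [2 + t] the shifted point still has all coordinates at least [1], where [D] is positive. *)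
  have := main [ffun=> 2 + t]; rewrite pmulr_lgt0.
    by apply=> e; rewrite ffunE lerDl ltW.
  apply: gram_det_gt0 => e; rewrite !ffunE; case: ifP => _; rewrite ?addrK ?ler1n //.
  by rewrite (le_trans (ler1n _ _ : 1 <= 2)) // lerDl ltW.
split; first by rewrite gt_eqF.
apply: posdef_gram_above => [e|y yl].
  by rewrite !ffunE; case: ifP => // _; rewrite gerBl ltW.
rewrite -(pmulr_rgt0 _ c0).
have -> : y = lower t S [ffun e => if e \in S then y e + t else y e].
  by apply/ffunP=> e; rewrite !ffunE; case: (e \in S) => //; rewrite addrK.
apply: main => e; have := yl e; rewrite !ffunE; case: ifP => // _.
by rewrite lerBlDr.
Qed.

End Selection.

(** * The graph *)

Section Incidence.
Variables (R : realFieldType) (m : nat).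
Local Notation n := m.+1.
Implicit Types (x y : 'cV[R]_n) (u v w : 'I_n).

Definition ones : 'cV[R]_n := const_mx 1.
(** The orthogonal projection onto constant vectors; adding it makes the Laplacian of a connected
    graph invertible. *)
Definition avg : 'M[R]_n := n%:R^-1 *: (ones *m ones^T).

Lemma n_neq0 : n%:R != 0 :> R. Proof. by rewrite pnatr_eq0. Qed.

Lemma dot_bvec u v x : dot (bvec R u v) x = x u 0 - x v 0.
Proof.
have E w : dot (evec R w) x = x w 0.
  rewrite /dot mxE (bigD1 w) //= !mxE eqxx mul1r big1 ?addr0 // => k kw.
  by rewrite !mxE (negPf kw) mul0r.
by rewrite /bvec dotC dotDr -scaleN1r dotZr ![dot x _]dotC !E mulN1r.
Qed.

Lemma dot_ones x : dot ones x = \sum_i x i 0.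
Proof. by rewrite /dot mxE; apply: eq_bigr => i _; rewrite !mxE mul1r. Qed.

Lemma avg_sym : avg^T = avg.
Proof. by rewrite /avg linearZ /= trmx_mul trmxK. Qed.

Lemma avgE x : avg *m x = (dot ones x / n%:R) *: ones.
Proof.
rewrite /avg -scalemxAl -mulmxA [ones^T *m x]mx11_scalar mul_mx_scalar scalerA.
by rewrite mulrC.
Qed.

Lemma dot_ones_ones : dot ones ones = n%:R.
Proof.
rewrite dot_ones (eq_bigr (fun=> 1)); last by move=> i _; rewrite mxE.
by rewrite sumr_const card_ord.
Qed.

Lemma avg_ones : avg *m ones = ones.
Proof. by rewrite avgE dot_ones_ones divff ?n_neq0 // scale1r. Qed.

Lemma avg_avg : avg *m avg = avg.
Proof. by rewrite {2}/avg -scalemxAr mulmxA avg_ones. Qed.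

Lemma bvec_ones u v : dot (bvec R u v) ones = 0.
Proof. by rewrite dot_bvec !mxE subrr. Qed.

Lemma avg_bvec u v : avg *m bvec R u v = 0.
Proof. by rewrite avgE dotC bvec_ones mul0r scale0r. Qed.

Lemma bilin_avg x : bilin avg x x = (dot ones x) ^+ 2 / n%:R.
Proof. by rewrite /avg bilinZ bilin_rank1 mulrC expr2. Qed.

Definition center x := x - avg *m x.

Lemma dot_bvec_center u v x : dot (bvec R u v) (center x) = dot (bvec R u v) x.
Proof.
by rewrite /center avgE dotDr -scaleNr dotZr bvec_ones mulr0 addr0.
Qed.

Lemma dot_ones_center x : dot ones (center x) = 0.
Proof.
rewrite /center dotDr avgE -scaleNr dotZr dot_ones_ones mulNr divfK ?n_neq0 //.
by rewrite subrr.
Qed.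

Lemma avg_center x : avg *m center x = 0.
Proof. by rewrite avgE dot_ones_center mul0r scale0r. Qed.

Definition edge_set (H : rel 'I_n) : {set 'I_n * 'I_n} :=
  [set p : 'I_n * 'I_n | (p.1 < p.2)%N && H p.1 p.2].

Lemma laplacianE (H : rel 'I_n) :
  laplacian R H = \sum_(p in edge_set H) bvec R p.1 p.2 *m (bvec R p.1 p.2)^T.
Proof.
rewrite /laplacian pair_big_dep /=; apply: eq_bigl => p.
by rewrite inE.
Qed.

Lemma connect_const (T : eqType) (H : rel 'I_n) (f : 'I_n -> T) :
  (forall u v, H u v -> f u = f v) -> forall u v, connect H u v -> f u = f v.
Proof.
move=> h u v /connectP[p]; elim: p u => [|w p IH] u /=; first by move=> _ ->.
by move=> /andP[/h -> pw] /(IH _ pw).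
Qed.

Variable G : rel 'I_n.
Hypotheses (G_simple : simple_graph G) (G_conn : connected_graph G).

Definition edge := {p : 'I_n * 'I_n | (p.1 < p.2)%N && G p.1 p.2}.

Definition edge_vec (e : edge) : 'cV[R]_n := bvec R (val e).1 (val e).2.

Local Notation I := edge.
Local Notation gramG := (gram edge_vec avg).

Lemma gram_bilin z x : bilin (gramG z) x x =
  \sum_e z e * dot (edge_vec e) x ^+ 2 + (dot ones x) ^+ 2 / n%:R.
Proof. by rewrite gramE bilin_avg. Qed.

Lemma laplacian_gram : laplacian R G + avg = gramG [ffun=> 1].
Proof.
rewrite laplacianE /gram; congr (_ + _).
have -> : edge_set G = [set val e | e in [set: I]].
  apply/setP=> p; rewrite inE; apply/idP/imsetP => [pP|[e _ ->]]; last exact: (valP e).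
  by exists (Sub p pP : I).
rewrite big_imset /=; last by move=> ? ? _ _; exact: val_inj.
by apply: eq_big => [e|e _]; rewrite ?inE // ffunE scale1r.
Qed.

(** A vector on which the form vanishes is constant along edges, hence constant by connectivity, and
    has sum zero. *)
Lemma edge_gram_posdef : posdef (gramG [ffun=> 1]).
Proof.
move=> x x0; rewrite lt_def gram_bilin.
have s0 : 0 <= \sum_e [ffun=> 1] e * dot (edge_vec e) x ^+ 2.
  by apply: sumr_ge0 => e _; rewrite ffunE mul1r sqr_ge0.
have t0 : 0 <= (dot ones x) ^+ 2 / n%:R by rewrite divr_ge0 ?sqr_ge0.
rewrite addr_ge0 // andbT; apply: contra x0; rewrite paddr_eq0 //.
rewrite mulf_eq0 invr_eq0 (negPf n_neq0) orbF sqrf_eq0 => /andP[sz /eqP oz].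
have ed e : dot (edge_vec e) x = 0.
  move: sz; rewrite psumr_eq0 => [|k _]; last by rewrite ffunE mul1r sqr_ge0.
  by move=> /allP/(_ e (mem_index_enum _)); rewrite ffunE mul1r sqrf_eq0 => /eqP.
have xG u v : G u v -> x u 0 = x v 0.
  move=> uv; have [uv'|vu|E] := ltngtP u v.
  - have P : ((u, v).1 < (u, v).2)%N && G (u, v).1 (u, v).2 by rewrite /= uv' uv.
    by have := ed (Sub (u, v) P); rewrite /edge_vec dot_bvec /= => /eqP;
      rewrite subr_eq0 => /eqP.
  - have P : ((v, u).1 < (v, u).2)%N && G (v, u).1 (v, u).2.
      by rewrite /= vu (G_simple.1) uv.
    by have := ed (Sub (v, u) P); rewrite /edge_vec dot_bvec /= => /eqP;
      rewrite subr_eq0 => /eqP.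
  - by rewrite (val_inj E).
have xc u : x u 0 = x 0 0 by apply: (connect_const xG); apply: G_conn.
have : dot ones x = n%:R * x 0 0.
  rewrite dot_ones (eq_bigr (fun=> x 0 0)) => [|i _]; last exact: xc.
  by rewrite sumr_const card_ord mulr_natl.
rewrite oz => /eqP; rewrite eq_sym mulf_eq0 (negPf n_neq0) /= => /eqP x00.
by apply/eqP/matrixP=> i j; rewrite ord1 xc x00 mxE.
Qed.

End Incidence.

(** * Effective resistances, and the selected edges as a spanning tree *)

Section SpanningTree.
Variables (R : realFieldType) (m : nat).
Local Notation n := m.+1.
Implicit Types (x y : 'cV[R]_n) (u v w : 'I_n).
Variable G : rel 'I_n.
Hypotheses (G_simple : simple_graph G) (G_conn : connected_graph G).

Local Notation I := (edge G).
Local Notation av := (@edge_vec R m G).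
Local Notation J := (avg R m).
Local Notation gramG := (gram av J).
Local Notation D := (gram_det av J).
Local Notation N := (gramG [ffun=> 1]).
Local Notation L := (laplacian R G).

Lemma avg_edge e : J *m av e = 0.
Proof. exact: avg_bvec. Qed.

Lemma laplacian_sym (H : rel 'I_n) : (laplacian R H)^T = laplacian R H.
Proof.
rewrite laplacianE linear_sum /=; apply: eq_bigr => p _.
by rewrite trmx_mul trmxK.
Qed.

Lemma avg_laplacian (H : rel 'I_n) : J *m laplacian R H = 0.
Proof.
rewrite laplacianE mulmx_sumr big1 // => p _.
by rewrite mulmxA avg_bvec mul0mx.
Qed.

Lemma laplacian_avg (H : rel 'I_n) : laplacian R H *m J = 0.
Proof.
by apply: trmx_inj; rewrite trmx_mul avg_sym laplacian_sym avg_laplacian trmx0.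
Qed.

Lemma gram_unit : N \in unitmx.
Proof. exact/posdef_unit/edge_gram_posdef. Qed.

(** [L = N - J] and [N J = J N = J], so both products of [L] with this matrix equal the projection
    [1 - J]. *)
Lemma pinv_laplacian : is_pinv L (invmx N - J).
Proof.
have uN := gram_unit.
have LN : L = N - J by rewrite -laplacian_gram addrK.
have JN : J *m N = J by rewrite -laplacian_gram mulmxDr avg_laplacian avg_avg add0r.
have NJ : N *m J = J by rewrite -laplacian_gram mulmxDl laplacian_avg avg_avg add0r.
have JV : J *m invmx N = J by have := mulmxK uN J; rewrite JN.
have VJ : invmx N *m J = J by have := mulKmx uN J; rewrite NJ.
have LX : L *m (invmx N - J) = 1%:M - J.
  by rewrite LN mulmxBl !mulmxBr mulmxV // NJ JV avg_avg subrr subr0.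
have XL : (invmx N - J) *m L = 1%:M - J.
  by rewrite LN mulmxBl !mulmxBr mulVmx // JN VJ avg_avg subrr subr0.
split.
- by rewrite LX mulmxBl mul1mx avg_laplacian subr0.
- by rewrite XL mulmxBl mul1mx mulmxBr JV avg_avg subrr subr0.
- by rewrite LX linearB /= trmx1 avg_sym.
- by rewrite XL linearB /= trmx1 avg_sym.
Qed.

Lemma eff_res_edge e :
  eff_res (invmx N - J) (val e).1 (val e).2 = dot (av e) (invmx N *m av e).
Proof. by rewrite /eff_res /dot -mulmxA mulmxBl avg_edge subr0. Qed.

(** With [w = N^-1 a_e] the resistance is [w^T N w], a sum of nonnegative terms one of which is its
    own square. *)
Lemma resistance_le1 e : dot (av e) (invmx N *m av e) <= 1.
Proof.
set w := invmx N *m av e; have Nw : N *m w = av e by rewrite mulKVmx // gram_unit.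
have : dot (av e) w ^+ 2 <= dot (av e) w.
  rewrite [X in _ <= X]dotC -Nw -/(bilin N w w) gram_bilin Nw.
  rewrite (bigD1 e) //= ffunE mul1r -addrA lerDl addr_ge0 //.
    by apply: sumr_ge0 => k _; rewrite ffunE mul1r sqr_ge0.
  by rewrite divr_ge0 // sqr_ge0.
by case: (lerP (dot (av e) w) 1) => //; nra.
Qed.

(** [D] is homogeneous of degree [m = n - 1]: doubling [z] multiplies the Gram matrix by [2 - J],
    whose determinant is [2^m]. *)
Lemma gram_det_dbl z : D (dbl z) = 2 ^+ m * D z.
Proof.
have -> : gram_det av J (dbl z) = \det ((2%:M - J) *m gramG z).
  congr determinant; rewrite mulmxBl mul_scalar_mx /gram mulmxDr avg_avg.
  have -> : J *m (\sum_e z e *: (av e *m (av e)^T)) = 0.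
    rewrite mulmx_sumr big1 // => e _.
    by rewrite -scalemxAr mulmxA avg_edge mul0mx scaler0.
  rewrite add0r scalerDr scaler_sumr -addrA; congr (_ + _).
    by apply: eq_bigr => e _; rewrite ffunE scalerA.
  by rewrite scaler_nat mulr2n addrK.
rewrite det_mulmx; congr (_ * _).
rewrite {1}/avg -scaleNr det_rank1_dot; last first.
  by rewrite unitmxE det_scalar unitrX // unitfE pnatr_eq0.
rewrite det_scalar invmx_scalar mul_scalar_mx dotZr dot_ones_ones exprS.
by move: (n_neq0 R m); move: (n%:R : R) => k k0; field.
Qed.

Section Tree.
Variable S : {set I}.
Hypothesis S_coef : coef S (enum {: I}) D [ffun=> 0] != 0.

Definition sel_graph : rel 'I_n :=
  fun u v => [exists e in S, (val e == (u, v)) || (val e == (v, u))].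

Lemma sel_graph_sym u v : sel_graph u v = sel_graph v u.
Proof. by apply: eq_existsb => e; rewrite orbC. Qed.

Lemma sel_graph_edges : edge_set sel_graph = [set val e | e in S].
Proof.
apply/setP=> -[u v]; rewrite inE /=; apply/andP/imsetP.
  move=> [uv /existsP[e /andP[eS]]] /orP[/eqP E|/eqP E]; first by exists e.
  by have := valP e; rewrite E /= ltnNge ltnW.
move=> [e eS E].
have /andP[uv _] : ((u, v).1 < (u, v).2)%N && G (u, v).1 (u, v).2.
  by rewrite E; exact: (valP e).
split=> //.
by apply/existsP; exists e; rewrite eS (_ : val e = (u, v)) ?eqxx.
Qed.

(** The degree of [D] fixes the support size of any nonzero coefficient. *)
Lemma card_selection : #|S| = m.
Proof.
have mD : multiaffine D by exact: multiaffine_gram_det.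
have := coef_homogeneous S (enum {: I}) [ffun=> 0] mD gram_det_dbl.
have -> : dbl [ffun=> 0] = [ffun=> 0] :> {ffun I -> R}.
  by apply/ffunP=> e; rewrite !ffunE mulr0.
move/(mulIf S_coef)/eqP; rewrite -!natrX eqr_nat eqn_exp2l // => /eqP cS; apply: etrans cS.
by rewrite cardE enumT /enum_mem size_filter; apply: eq_count.
Qed.

(** Otherwise the centred indicator of a component lies in the kernel of the Gram matrix at every
    [z] supported on [S], so the coefficient vanishes. *)
Lemma selection_connected : connected_graph sel_graph.
Proof.
move=> u0 v0; apply/negPn/negP => nuv; case/negP: S_coef.
apply/eqP/coef_vanish => z hz.
pose x : 'cV[R]_n := \col_w (connect sel_graph u0 w)%:R.
pose y := center x.
have sc : connect_sym sel_graph.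
  by apply: sym_connect_sym => u v; exact: sel_graph_sym.
have y0 : y != 0.
  apply/eqP => yz; have := dot_bvec_center u0 v0 x; rewrite -/y yz dot0r dot_bvec.
  by rewrite !mxE connect0 (negPf nuv) subr0 => /eqP; rewrite eq_sym oner_eq0.
have ey e : e \in S -> dot (av e) y = 0.
  move=> eS; rewrite dot_bvec_center dot_bvec !mxE.
  have h : sel_graph (val e).1 (val e).2.
    by apply/existsP; exists e; rewrite eS -surjective_pairing eqxx.
  by rewrite (same_connect_r sc (connect1 h)) subrr.
have gy : gramG z *m y = 0.
  rewrite mulmxDl avg_center addr0 mulmx_suml big1 // => e _.
  have [eS|eS] := boolP (e \in S); last first.
    by rewrite hz ?mem_enum // scale0r mul0mx.
  rewrite -scalemxAl -mulmxA [_ *m y]mx11_scalar mul_mx_scalar.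
  by rewrite -[_ 0 0]/(dot (av e) y) ey // scale0r scaler0.
apply/eqP/det0P; exists y^T; first by rewrite -[0]trmx0 (inj_eq trmx_inj).
by rewrite -[gramG z](gram_sym _ _ (avg_sym R m)) -trmx_mul gy trmx0.
Qed.

Lemma selection_spanning_tree : spanning_tree G sel_graph.
Proof.
have [Gs Gi] := G_simple.
have sub : subgraph sel_graph G.
  move=> u v /existsP[e /andP[_ /orP[/eqP E|/eqP E]]]; have := valP e;
  by rewrite E /= => /andP[_] //; rewrite Gs.
split; first by split=> [u v|u]; [exact: sel_graph_sym | apply/negP => /sub; exact/negP].
split=> //; split; first exact: selection_connected.
rewrite /num_edges -[X in #|pred_of_set X|]/(edge_set _) sel_graph_edges.
by rewrite card_imset ?card_selection //; exact: val_inj.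
Qed.

(** Both Laplacians ignore centring, and on centred vectors the form in the hypothesis is that of
    [2 L_G - t L_T]. *)
Lemma selection_loewner t c : 0 < t -> 2 / t <= c ->
  posdef (gramG (lower t S [ffun=> 2])) ->
  loewner_le (laplacian R sel_graph) (c *: L).
Proof.
move=> t0 tc pd x; rewrite -mulmxA -[X in 0 <= X]/(bilin _ x x).
rewrite bilinD -scaleN1r !bilinZ mulN1r subr_ge0.
have -> : bilin L x x = \sum_e dot (av e) x ^+ 2.
  have := gram_bilin ([ffun=> 1] : {ffun I -> R}) x; rewrite -laplacian_gram bilinD bilin_avg.
  by move/addIr => ->; apply: eq_bigr => e _; rewrite ffunE mul1r.
have -> : bilin (laplacian R sel_graph) x x = \sum_(e in S) dot (av e) x ^+ 2.
  rewrite laplacianE sel_graph_edges big_imset /=; last by move=> ? ? _ _; exact: val_inj.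
  rewrite /bilin mulmx_suml /dot mulmx_sumr summxE; apply: eq_bigr => e _.
  by rewrite -[LHS]/(bilin (av e *m (av e)^T) x x) bilin_rank1 expr2.
have : 0 <= bilin (gramG (lower t S [ffun=> 2])) (center x) (center x).
  have [->|c0] := eqVneq (center x) 0; first by rewrite /bilin mulmx0 dot0r.
  exact/ltW/pd.
rewrite gram_bilin dot_ones_center expr0n mul0r addr0.
rewrite (eq_bigr (fun e => 2 * dot (av e) x ^+ 2 -
    t * (if e \in S then dot (av e) x ^+ 2 else 0))); last first.
  move=> e _; rewrite dot_bvec_center !ffunE -/(av e).
  by case: ifP => _; ring.
rewrite sumrB -!mulr_sumr -big_mkcond /= subr_ge0 => h.
apply: le_trans (ler_wpM2r _ tc); last by apply: sumr_ge0 => e _; exact: sqr_ge0.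
by rewrite mulrAC ler_pdivlMr // mulrC.
Qed.

End Tree.
End SpanningTree.

(** * The spanning tree bound with constant [8] *)

Theorem theorem4p9 (R : realFieldType) :
  exists c : R, 0 < c /\
  forall (n : nat) (G : rel 'I_n) (kappa : R),
    simple_graph G -> connected_graph G -> 0 < kappa ->
    (forall (u v : 'I_n) (X : 'M[R]_n), G u v -> is_pinv (laplacian R G) X ->
        kappa <= (eff_res X u v)^-1) ->
    exists T : rel 'I_n, spanning_tree G T /\
      loewner_le (laplacian R T) ((c / kappa) *: laplacian R G).
Proof.
(* The thinness is [2 / t = 8 beta] for [t = 1 / (4 beta)], and [beta <= 1 / kappa]. For [n = 0] the
   graph [G] itself serves, as [n.-1 = 0]. *)
exists 8; split=> // -[|m] G kappa Gs Gc k0 hk.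
  exists G; split; last by move=> x; rewrite mxE big_ord0.
  split=> //; split=> //; split=> //.
  by apply/eqP; rewrite cards_eq0; apply/eqP/setP => -[[]].
(* The minimum of [1] and [1 / kappa]: [thin_selection] requires [beta <= 1], and resistances never
   exceed [1]. *)
pose beta := (Num.max kappa 1)^-1.
have M0 : 0 < Num.max kappa 1 by rewrite lt_max k0.
have b0 : 0 < beta by rewrite invr_gt0.
have b1 : beta <= 1 by rewrite invf_le1 // le_max lexx orbT.
have hb (e : edge G) :
    dot (edge_vec R e) (invmx (gram (@edge_vec R m G) (avg R m) [ffun=> 1]) *m
                      edge_vec R e) <= beta.
  rewrite /beta; case: (leP kappa 1) => _; first by rewrite invr1 resistance_le1.
  have /andP[_ ge] := valP e; have := hk _ _ _ ge (pinv_laplacian R Gs Gc).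
  rewrite eff_res_edge; move: (dot _ _) => s hs.
  have s0 : 0 < s by rewrite -invr_gt0; apply: lt_le_trans hs.
  by rewrite -[s]invrK lef_pV2 // posrE ?invr_gt0.
have [S [cS pS]] := thin_selection (avg_sym R m) (edge_gram_posdef Gs Gc) b0 b1 hb.
exists (sel_graph S); split; first exact: (selection_spanning_tree Gs cS).
have t0 : 0 < (4 * beta)^-1 by rewrite invr_gt0; lra.
have bk : beta <= kappa^-1 by rewrite lef_pV2 ?posrE // le_max lexx.
by apply: (selection_loewner t0 _ pS); rewrite invrK; lra.
Qed.
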